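(* Let $n\ge3$, $2\le k\le n-1$, $A\in\mathcal A_k$, $b\in\mathbb R^n$, $D\subset\mathbb R^n$ a bounded domain, $\Omega:=\mathbb R^n\setminus\overline D$, and $Q_c(x):=\frac12x^TAx+b\cdot x+c$. Assume one of the following: (a) $D$ is a uniformly convex $C^{1,1}$ domain, $\varphi\in C^0(\partial D)$ is uniformly semiconvex with respect to $\partial D$, and, for $c$ large, $u=u_c\in C^0(\overline\Omega)$ denotes the unique $k$-admissible viscosity solution of $\sigma_k(\lambda(D^2u))=1$ in $\Omega$, $u=\varphi$ on $\partial D$, with $u(x)=Q_c(x)+O(|x|^{2-n})$ as $|x|\to\infty$; (b) $D$ is a smooth, strictly star-shaped domain with strictly $(k-1)$-convex boundary, $\varphi\in C^\infty(\partial D)$, and, for $c$ large, $u=u_c\in C^\infty(\overline\Omega)$ denotes the unique $k$-admissible solution of the same problem with the same asymptotics. Then there is a constant $C$, depending only on the fixed data $(n,k,A,b,D,\varphi)$ and not on $c$, such that for all sufficiently large $c$, $$Q_c(x)-C\,c^{\,n-1}|x|^{2-n}\le u(x)\le Q_c(x),\qquad |x|\ge c.$$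
   Context: For a real symmetric $n\times n$ matrix $M$, $\lambda(M)$ is its vector of eigenvalues; $\sigma_j$ is the $j$-th elementary symmetric function; $\Gamma_k=\{\lambda\in\mathbb R^n:\sigma_j(\lambda)>0,\ j=1,\dots,k\}$; $\mathcal A_k=\{A\in\mathrm{Sym}(n):\lambda(A)\in\Gamma_k,\ \sigma_k(\lambda(A))=1\}$. A $C^2$ function $v$ is $k$-admissible if $\lambda(D^2v)\in\Gamma_k$ in $\Omega$. In both settings the solution $u_c$ exists and is unique for all sufficiently large $c$. $k$-admissible viscosity solution: a continuous $u$ such that (subsolution) whenever $\psi\in C^2$ near $x_0\in\Omega$ and $u-\psi$ has a local maximum at $x_0$, then $\lambda(D^2\psi(x_0))\in\Gamma_k$ and $\sigma_k(\lambda(D^2\psi(x_0)))\ge1$; and (supersolution) whenever $\psi\in C^2$ near $x_0\in\Omega$, $u-\psi$ has a local minimum at $x_0$ and $\lambda(D^2\psi(x_0))\in\Gamma_k$, then $\sigma_k(\lambda(D^2\psi(x_0)))\le1$. Let $\nu$ be the exterior unit normal to $\partial D$. Uniformly convex: there exist $r_D,c_D,\kappa_D,\xi_D>0$ such that for all $\xi,x\in\partial D$: $-c_D|x-\xi|^2\le (x-\xi)\cdot\nu(\xi)\le-\kappa_D|x-\xi|^2$ if $|x-\xi|<r_D$, and $(x-\xi)\cdot\nu(\xi)\le-\xi_D$ if $|x-\xi|\ge r_D$. Uniformly semiconvex with respect to $\partial D$: there exist $r_\varphi,K_\varphi,P_\varphi>0$ such that for every $\xi\in\partial D$ there is $\tau_\xi\in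 T_\xi\partial D$ with $|\tau_\xi|\le P_\varphi$ and $\varphi(x)\ge\varphi(\xi)+\tau_\xi\cdot(x-\xi)-K_\varphi|x-\xi|^2$ for all $x\in\partial D$ with $|x-\xi|<r_\varphi$. $\partial D$ is strictly $(k-1)$-convex if the vector $\kappa(\xi)\in\mathbb R^{n-1}$ of principal curvatures (positive for spheres) satisfies $\sigma_j(\kappa(\xi))>0$ for $j=1,\dots,k-1$ and all $\xi\in\partial D$. $D$ is strictly star-shaped if there is $x_0\in D$ with $(x-x_0)\cdot\nu(x)>0$ for all $x\in\partial D$. *)

(* Defs.v *)
(* Points of R^n are row vectors. *)
From HB Require Import structures.
From mathcomp Require Import all_boot all_order all_algebra.
From mathcomp Require Import complex.
From mathcomp Require Import all_classical all_reals all_analysis.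

Set Implicit Arguments.
Unset Strict Implicit.
Unset Printing Implicit Defensive.

Import Order.TTheory GRing.Theory Num.Theory.
Import numFieldNormedType.Exports.

Local Open Scope classical_set_scope.
Local Open Scope ring_scope.

(* The norm that the library puts on 'rV[R]_n is the sup norm; it is used only
   through the topology, differentiability and boundedness it induces.  Every
   |x| of the statement is the Euclidean norm below. *)
Definition dot (R : realType) (n : nat) (x y : 'rV[R]_n) : R :=
  \sum_i x 0 i * y 0 i.

Definition enorm (R : realType) (n : nat) (x : 'rV[R]_n) : R :=
  Num.sqrt (dot x x).

Lemma char_poly_conj (F : fieldType) n (P D : 'M[F]_n) : P \in unitmx ->
  char_poly (invmx P *m D *m P) = char_poly D.
Proof.
move=> uP; pose c := @map_mx _ _ (@polyC F) n n.
have uc : c (invmx P) *m c P = 1%:M by rewrite -map_mxM mulVmx // map_mx1.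
rewrite /char_poly.
have -> : char_poly_mx (invmx P *m D *m P) =
    c (invmx P) *m char_poly_mx D *m c P.
  rewrite /char_poly_mx mulmxBr mulmxBl !map_mxM; congr (_ - _).
  by rewrite scalar_mxC -mulmxA uc mulmx1.
by rewrite !det_mulmx mulrAC -det_mulmx uc det1 mul1r.
Qed.

Lemma symmetric_char_poly_split (R : rcfType) (n : nat) (M : 'M[R]_n) :
  M^T = M ->
  exists l : 'rV[R]_n, char_poly M = \prod_i ('X - (l 0 i)%:P).
Proof.
move=> symM; pose toC := real_complex R; pose MC := map_mx toC M.
have realMC : MC \is a mxOver Num.real.
  by apply/mxOverP => i j; rewrite mxE complex_real.
have hermMC : MC \is hermsymmx.
  apply: realsym_hermsym realMC; apply/is_hermitianmxP.
  by rewrite expr0 scale1r map_mx_id // map_trmx symM.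
have /orthomx_spectralP MCE := hermitian_normalmx hermMC.
have /mxOverP realD := hermitian_spectral_diag_real hermMC.
exists (\row_i complex.Re (spectral_diag MC 0 i)).
apply: (map_poly_inj toC); rewrite map_char_poly -/MC.
rewrite [in LHS]MCE char_poly_conj ?spectral_unit //.
rewrite char_poly_trig ?diag_mx_is_trig // rmorph_prod.
apply: eq_bigr => i _; rewrite rmorphB /= map_polyX map_polyC /= !mxE eqxx.
by rewrite RRe_real.
Qed.

Definition symmetric_mx (R : realType) (n : nat) (M : 'M[R]_n) : Prop :=
  M^T = M.

(* lambda(M): the eigenvalues with multiplicity, in an unspecified order (they
   are only used in symmetric functions). *)
Definition eigenvalues (R : realType) (n : nat) (M : 'M[R]_n) : 'rV[R]_n :=
  xget 0 [set l : 'rV[R]_n | char_poly M = \prod_i ('X - (l 0 i)%:P)].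

Lemma eigenvaluesP (R : realType) (n : nat) (M : 'M[R]_n) :
  symmetric_mx M ->
  char_poly M = \prod_i ('X - (eigenvalues M 0 i)%:P).
Proof.
move=> /symmetric_char_poly_split [l hl]; rewrite /eigenvalues.
by case: xgetP => [v _ //|/(_ l)].
Qed.

Definition sigma (R : realType) (n : nat) (j : nat) (l : 'rV[R]_n) : R :=
  \sum_(S : {set 'I_n} | #|S| == j) \prod_(i in S) l 0 i.

Definition Gamma (R : realType) (n : nat) (k : nat) : set 'rV[R]_n :=
  [set l | forall j : nat, (1 <= j <= k)%N -> 0 < sigma j l].

Definition calA (R : realType) (n : nat) (k : nat) : set 'M[R]_n :=
  [set A | [/\ symmetric_mx A, Gamma k (eigenvalues A)
             & sigma k (eigenvalues A) = 1]].

Definition Q (R : realType) (n : nat) (A : 'M[R]_n) (b : 'rV[R]_n) (c : R)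
    (x : 'rV[R]_n) : R :=
  2^-1 * dot (x *m A) x + dot b x + c.

Definition stdbasis (R : realType) (n : nat) (i : 'I_n) : 'rV[R]_n :=
  delta_mx 0 i.

(* partial [:: i; j; ...] f = d_i d_j ... f *)
Definition partial (R : realType) (n : nat) (s : seq 'I_n)
    (f : 'rV[R]_n -> R) : 'rV[R]_n -> R :=
  foldr (fun i (g : 'rV[R]_n -> R) x => 'D_(stdbasis R i) g x) f s.

Definition grad (R : realType) (n : nat) (f : 'rV[R]_n -> R) (x : 'rV[R]_n) :
    'rV[R]_n :=
  \row_i partial [:: i] f x.

Definition hessian (R : realType) (n : nat) (f : 'rV[R]_n -> R)
    (x : 'rV[R]_n) : 'M[R]_n :=
  \matrix_(i, j) partial [:: i; j] f x.

(* C^m(U), meant for U open. *)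
Definition class_C (R : realType) (n m : nat) (U : set 'rV[R]_n)
    (f : 'rV[R]_n -> R) : Prop :=
  forall (s : seq 'I_n) (x : 'rV[R]_n), U x ->
    ((size s <= m)%N -> {for x, continuous (partial s f)}) /\
    ((size s < m)%N -> differentiable (partial s f) x).

Definition smooth (R : realType) (n : nat) (U : set 'rV[R]_n)
    (f : 'rV[R]_n -> R) : Prop :=
  forall m : nat, class_C m U f.

(* C^infty(closure U): f is smooth in U, continuous on closure U, and every
   derivative of f extends continuously from U to closure U. *)
Definition smooth_closure (R : realType) (n : nat) (U : set 'rV[R]_n)
    (f : 'rV[R]_n -> R) : Prop :=
  [/\ smooth U f,
      {within closure U, continuous f}
    & forall s : seq 'I_n, exists g : 'rV[R]_n -> R,
        {within closure U, continuous g} /\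
        (forall x, U x -> g x = partial s f x)].

Definition C11 (R : realType) (n : nat) (f : 'rV[R]_n -> R) : Prop :=
  class_C 1 setT f /\
  exists L : R, forall x y : 'rV[R]_n,
    enorm (grad f x - grad f y) <= L * enorm (x - y).

Definition bdry (R : realType) (n : nat) (D : set 'rV[R]_n) : set 'rV[R]_n :=
  closure D `\` interior D.

Definition exterior (R : realType) (n : nat) (D : set 'rV[R]_n) :
    set 'rV[R]_n :=
  ~` closure D.

Definition bounded_domain (R : realType) (n : nat) (D : set 'rV[R]_n) : Prop :=
  [/\ open D, connected D, D !=set0 & bounded_set D].

(* In the ball of radius r about xi, D is the part lying under the graph, in
   direction e, of a function on the hyperplane orthogonal to e; that function
   is represented by its extension gamma to R^n that is constant along e. *)
Definition graph_chart (R : realType) (n : nat) (D : set 'rV[R]_n)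
    (xi : 'rV[R]_n) (r : R) (e : 'rV[R]_n) (gamma : 'rV[R]_n -> R) : Prop :=
  [/\ 0 < r, enorm e = 1,
      forall (x : 'rV[R]_n) (t : R), gamma (x + t *: e) = gamma x
    & forall x : 'rV[R]_n, enorm (x - xi) < r -> (D x <-> dot x e < gamma x)].

Definition boundary_of_class (R : realType) (n : nat)
    (P : ('rV[R]_n -> R) -> Prop) (D : set 'rV[R]_n) : Prop :=
  forall xi, bdry D xi ->
    exists r e gamma, graph_chart D xi r e gamma /\ P gamma.

Definition C11_domain (R : realType) (n : nat) (D : set 'rV[R]_n) : Prop :=
  boundary_of_class (@C11 R n) D.

Definition smooth_domain (R : realType) (n : nat) (D : set 'rV[R]_n) : Prop :=
  boundary_of_class (smooth setT) D.

(* The exterior unit normal: near xi, D is the sublevel set {rho < 0} of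
   rho(x) = x . e - gamma(x), and nu(xi) = grad rho(xi) / |grad rho(xi)|. *)
Definition nu (R : realType) (n : nat) (D : set 'rV[R]_n) (xi : 'rV[R]_n) :
    'rV[R]_n :=
  xget 0 [set v | exists r e gamma,
    [/\ graph_chart D xi r e gamma, class_C 1 setT gamma
      & v = (enorm (e - grad gamma xi))^-1 *: (e - grad gamma xi)]].

(* The principal curvatures: in a chart whose direction e is the exterior
   normal at xi (grad gamma xi = 0), they are the eigenvalues of minus the
   Hessian of gamma on the tangent space.  The Hessian of the extension of
   gamma to R^n has the extra eigenvalue 0 in direction e, hence the factor 'X.
   With D under the graph, the sphere of radius r has curvatures 1/r. *)
Definition principal_curvatures (R : realType) (n : nat) (D : set 'rV[R]_n)
    (xi : 'rV[R]_n) : 'rV[R]_n.-1 :=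
  xget 0 [set kappa : 'rV[R]_n.-1 | exists r e gamma,
    [/\ graph_chart D xi r e gamma, class_C 2 setT gamma, grad gamma xi = 0
      & char_poly (- hessian gamma xi) =
          'X * \prod_i ('X - (kappa 0 i)%:P)]].

Definition uniformly_convex (R : realType) (n : nat) (D : set 'rV[R]_n) :
    Prop :=
  exists rD cD kD xiD : R,
    [/\ 0 < rD, 0 < cD, 0 < kD & 0 < xiD] /\
    forall xi x : 'rV[R]_n, bdry D xi -> bdry D x ->
      (enorm (x - xi) < rD ->
         - cD * enorm (x - xi) ^+ 2 <= dot (x - xi) (nu D xi)
           <= - kD * enorm (x - xi) ^+ 2) /\
      (rD <= enorm (x - xi) -> dot (x - xi) (nu D xi) <= - xiD).

Definition tangent_space (R : realType) (n : nat) (D : set 'rV[R]_n)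
    (xi : 'rV[R]_n) : set 'rV[R]_n :=
  [set tau | dot tau (nu D xi) = 0].

Definition uniformly_semiconvex (R : realType) (n : nat) (D : set 'rV[R]_n)
    (phi : 'rV[R]_n -> R) : Prop :=
  exists r K P : R, [/\ 0 < r, 0 < K & 0 < P] /\
    forall xi, bdry D xi ->
      exists tau, [/\ tangent_space D xi tau, enorm tau <= P
        & forall x, bdry D x -> enorm (x - xi) < r ->
            phi xi + dot tau (x - xi) - K * enorm (x - xi) ^+ 2 <= phi x].

Definition strictly_star_shaped (R : realType) (n : nat) (D : set 'rV[R]_n) :
    Prop :=
  exists2 x0, D x0 & forall x, bdry D x -> 0 < dot (x - x0) (nu D x).

Definition strictly_convex_boundary (R : realType) (n : nat) (j : nat)
    (D : set 'rV[R]_n) : Prop :=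
  forall xi, bdry D xi -> Gamma j (principal_curvatures D xi).

Definition smooth_on_boundary (R : realType) (n : nat) (D : set 'rV[R]_n)
    (phi : 'rV[R]_n -> R) : Prop :=
  forall xi, bdry D xi -> exists (U : set 'rV[R]_n) (g : 'rV[R]_n -> R),
    [/\ open U, U xi, smooth U g & forall x, U x -> bdry D x -> phi x = g x].

Definition C2_near (R : realType) (n : nat) (x0 : 'rV[R]_n)
    (psi : 'rV[R]_n -> R) : Prop :=
  exists U : set 'rV[R]_n, [/\ open U, U x0 & class_C 2 U psi].

Definition viscosity_subsolution (R : realType) (n k : nat)
    (Om : set 'rV[R]_n) (u : 'rV[R]_n -> R) : Prop :=
  forall (x0 : 'rV[R]_n) (psi : 'rV[R]_n -> R), Om x0 -> C2_near x0 psi ->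
    (\forall x \near x0, u x - psi x <= u x0 - psi x0) ->
    Gamma k (eigenvalues (hessian psi x0)) /\
    1 <= sigma k (eigenvalues (hessian psi x0)).

Definition viscosity_supersolution (R : realType) (n k : nat)
    (Om : set 'rV[R]_n) (u : 'rV[R]_n -> R) : Prop :=
  forall (x0 : 'rV[R]_n) (psi : 'rV[R]_n -> R), Om x0 -> C2_near x0 psi ->
    (\forall x \near x0, u x0 - psi x0 <= u x - psi x) ->
    Gamma k (eigenvalues (hessian psi x0)) ->
    sigma k (eigenvalues (hessian psi x0)) <= 1.

Definition admissible (R : realType) (n k : nat) (Om : set 'rV[R]_n)
    (v : 'rV[R]_n -> R) : Prop :=
  class_C 2 Om v /\ forall x, Om x -> Gamma k (eigenvalues (hessian v x)).

(* u(x) = Q_c(x) + O(|x|^(2-n)) as |x| -> oo, for n >= 2. *)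
Definition asymptotic_to_Q (R : realType) (n : nat) (A : 'M[R]_n)
    (b : 'rV[R]_n) (c : R) (u : 'rV[R]_n -> R) : Prop :=
  exists M r : R, forall x : 'rV[R]_n, r <= enorm x ->
    `|u x - Q A b c x| <= M * enorm x ^- (n - 2).

Definition viscosity_solution (R : realType) (n k : nat) (A : 'M[R]_n)
    (b : 'rV[R]_n) (D : set 'rV[R]_n) (phi : 'rV[R]_n -> R) (c : R)
    (u : 'rV[R]_n -> R) : Prop :=
  [/\ {within closure (exterior D), continuous u},
      viscosity_subsolution k (exterior D) u /\
      viscosity_supersolution k (exterior D) u,
      forall x, bdry D x -> u x = phi x
    & asymptotic_to_Q A b c u].

Definition classical_solution (R : realType) (n k : nat) (A : 'M[R]_n)
    (b : 'rV[R]_n) (D : set 'rV[R]_n) (phi : 'rV[R]_n -> R) (c : R)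
    (u : 'rV[R]_n -> R) : Prop :=
  [/\ smooth_closure (exterior D) u,
      admissible k (exterior D) u /\
      (forall x, exterior D x -> sigma k (eigenvalues (hessian u x)) = 1),
      forall x, bdry D x -> u x = phi x
    & asymptotic_to_Q A b c u].

(* Main.v *)
Require Import Defs.
From HB Require Import structures.
From mathcomp Require Import all_boot all_order all_algebra.
From mathcomp Require Import fraction complex zify ring lra.
From mathcomp Require Import all_classical all_reals all_analysis.

Set Implicit Arguments.
Unset Strict Implicit.
Unset Printing Implicit Defensive.

Import Order.TTheory GRing.Theory Num.Theory.
Import numFieldNormedType.Exports.

Local Open Scope classical_set_scope.
Local Open Scope ring_scope.

(** Both parts are comparison arguments in the exterior domain Omega; a
classical solution is in particular a viscosity solution, so only viscosity
solutions are compared with smooth functions.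

Upper bound ([upper_bound]).  Q_c solves the equation, exceeds phi on the
boundary once c is large, and differs from u by o(1) at infinity, so u <= Q_c.

Lower bound ([exterior_estimate]).  Comparing u with Q_(-M), where M bounds
phi - Q_0 on the boundary, gives u >= Q_c - (c + M) in all of Omega
([crude_lower_bound]).  It remains to make the defect, of size at most 2c at
distance about c, decay like |x|^(2-n) beyond that distance.  Let a be the
coefficient matrix of the linearization of sigma_k at A; it is positive definite
because A is k-admissible.  With B the inverse of a, s(x) = x B x^T and
rho = s^(-1/2), the function rho^(n-2) is a fundamental solution of the
linearized operator, and subtracting a multiple of rho^(n-1) makes it a strict
supersolution of that operator.  Put
  w = Q_c - N (rho^(n-2) - theta rho^(n-1)),
with theta comparable to c and N comparable to c^(n-1).  Where |x| is at least
of order c, the Hessian of w differs from A by O(1/c), so the quadratic error of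
the linearization is smaller than the gain from the correction term, and w is an
admissible subsolution there ([radial_barrier]).  On the inner level set of s,
w = Q_c - 3c <= u, and w <= Q_c at infinity.  Hence w <= u, which is the claim,
with the constant C = 4.

The Hessian of w is A + p B - q (xB)^T (xB) with p, q >= 0.  In an
eigenbasis of A it is a diagonal matrix minus a rank one matrix, and sigma_j
of such a matrix is explicit ([sigma_diag_rank1]); so no general perturbation
theory of eigenvalues enters.  The same formula gives the monotonicity of
sigma_k on k-admissible symmetric matrices ([Gamma_psd]), on which the comparison
principles and the passage from classical to viscosity solutions rest.  Both
uses need the positivity of the derivatives of sigma_k in Gamma_k
([Gamma_zero_at]), which is deduced from Newton's inequality. *)

(** * Real-rooted polynomials *)

Section Newton.
Variable R : realType.

(** The logarithmic derivative of a polynomial with real roots is the sum of the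
1 / (z - x); each term has imaginary part of sign opposite to that of z.  Thus
the derivative has no root off the real line. *)
Lemma Im_log_deriv_sign (s : seq R) (z : R[i]) : complex.Im z != 0 ->
  let p := \prod_(x <- s) ('X - (x%:C)%C%:P) in
  p.[z] != 0 /\
  ((0 < size s)%N -> complex.Im (p^`().[z] / p.[z]) * complex.Im z < 0).
Proof.
move=> z0 /=; elim: s => [|x s [p0 IH]].
  by rewrite big_nil hornerC oner_eq0; split.
rewrite big_cons; set p := \prod_(_ <- s) _ in p0 IH *.
have zx0 : z - (x%:C)%C != 0.
  by apply: contraNneq z0 => /eqP; rewrite subr_eq0 => /eqP ->.
split; first by rewrite hornerM hornerXsubC; apply: mulf_neq0.
move=> _.
have -> : (('X - (x%:C)%C%:P) * p)^`().[z] / (('X - (x%:C)%C%:P) * p).[z] =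
    (z - (x%:C)%C)^-1 + p^`().[z] / p.[z].
  rewrite derivM derivXsubC mul1r hornerD !hornerM hornerXsubC.
  by rewrite mulrDl invfM mulrCA divff // mulr1 mulrACA divff // mul1r.
rewrite raddfD /= mulrDl.
have lt0 : complex.Im (z - (x%:C)%C)^-1 * complex.Im z < 0.
  case: z z0 {p0 IH zx0 p} => a b /= b0; rewrite oppr0 addr0.
  rewrite mulNr oppr_lt0 mulrAC -expr2 divr_gt0 ?exprn_even_gt0 //.
  by rewrite ltr_wpDl ?sqr_ge0 // exprn_even_gt0.
have [s0|s0] := posnP (size s).
  by rewrite /p (size0nil s0) big_nil derivC horner0 mul0r mul0r addr0.
by rewrite (lt_trans _ lt0) // gtrDl IH.
Qed.

Definition splits (p : {poly R}) : Prop :=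
  exists (a : R) (s : seq R), p = a *: \prod_(x <- s) ('X - x%:P).

(** Over the complex numbers the derivative splits, and all its roots are
real by the lemma above. *)
Lemma splits_deriv (p : {poly R}) : splits p -> splits p^`().
Proof.
move=> [a [s ->]]; rewrite derivZ.
suff [b [r ->]] : splits (\prod_(x <- s) ('X - x%:P))^`().
  by exists (a * b), r; rewrite scalerA.
set p0 := (X in X^`()).
have [->|d0] := eqVneq p0^`() 0; first by exists 0, [::]; rewrite scale0r.
pose toC := real_complex R.
have [r /= rE] := closed_field_poly_normal (map_poly toC p0^`()).
have mp0 : map_poly toC p0 = \prod_(x <- s) ('X - (x%:C)%C%:P).
  by rewrite rmorph_prod; apply: eq_bigr => x _; rewrite rmorphB /= map_polyX map_polyC.
have l0 : lead_coef (map_poly toC p0^`()) != 0 by rewrite lead_coef_eq0 map_poly_eq0.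
exists (lead_coef p0^`()), [seq complex.Re z | z <- r]; apply: (map_poly_inj toC).
rewrite [LHS]rE lead_coef_map map_polyZ /= big_map; congr (_ *: _).
rewrite rmorph_prod; rewrite big_seq [RHS]big_seq; apply: eq_bigr => z zr.
rewrite rmorphB /= map_polyX map_polyC /=; congr ('X - _%:P).
have [z0|z0] := eqVneq (complex.Im z) 0; first by apply/eqP; rewrite eq_complex /= z0 !eqxx.
exfalso.
have [p0z IH] := Im_log_deriv_sign s z0.
have rz : (map_poly toC p0)^`().[z] = 0.
  rewrite deriv_map rE hornerZ; apply/eqP; rewrite mulf_eq0 (negbTE l0) /=.
  by rewrite -/(root _ _) root_prod_XsubC.
rewrite -mp0 in IH.
case: (posnP (size s)) => [s0|/IH]; last by rewrite rz mul0r mul0r ltxx.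
by move: d0; rewrite /p0 (size0nil s0) big_nil derivC eqxx.
Qed.

Lemma splits_derivn (p : {poly R}) m : splits p -> splits p^`(m).
Proof. by move=> ps; elim: m => [//|m /splits_deriv]; rewrite derivnS. Qed.

(** Laguerre's inequality: p'^2 - p p'' is p^2 times the sum of the
1 / (x - x_i)^2.  The induction on the roots avoids the division. *)
Lemma laguerre (p : {poly R}) x : splits p ->
  p.[x] * p^`(2).[x] <= p^`().[x] ^+ 2.
Proof.
move=> [a [s ->]]; rewrite -[2%N]/(1 + 1)%N !derivnS derivn0 !derivZ !hornerZ.
set p0 := \prod_(_ <- _) _.
suff : p0.[x] * p0^`()^`().[x] <= p0^`().[x] ^+ 2.
  move=> h; rewrite exprMn mulrACA -expr2 ler_wpM2l ?sqr_ge0 //.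
rewrite {}/p0; elim: s => [|y s]; first by rewrite big_nil !derivC !horner0 mulr0 expr2 mulr0.
rewrite big_cons; set p0 := \prod_(_ <- _) _ => IH.
rewrite derivM derivXsubC mul1r derivD derivM derivXsubC mul1r !(hornerXsubC, hornerD, hornerM).
rewrite -subr_ge0 in IH.
rewrite -subr_ge0 (_ : _ - _ = p0.[x] ^+ 2 + (x - y) ^+ 2 *
  (p0^`().[x] ^+ 2 - p0.[x] * (p0^`())^`().[x])); last first.
  by ring.
by rewrite addr_ge0 ?sqr_ge0 // mulr_ge0 ?sqr_ge0.
Qed.
End Newton.

(** * Elementary symmetric functions and Newton's inequality *)

Section Sigma.
Variables (R : realType) (n : nat).
Implicit Types l h : 'rV[R]_n.

Lemma sigma0 l : sigma 0 l = 1.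
Proof.
rewrite /sigma (eq_bigl (pred1 (@finset.set0 'I_n))) => [|S].
  by rewrite big_pred1_eq big_set0.
by rewrite cards_eq0.
Qed.

Lemma sigma_gt j l : (n < j)%N -> sigma j l = 0.
Proof.
move=> nj; rewrite /sigma big_pred0 // => S.
by apply: contraTF nj => /eqP <-; rewrite -leqNgt -[X in (_ <= X)%N]card_ord max_card.
Qed.

Lemma coef_prod_sigma l j : (j <= n)%N ->
  (\prod_i ('X - (l 0 i)%:P))`_(n - j) = (-1) ^+ j * sigma j l.
Proof.
move=> jn; rewrite (eq_bigr (fun i => - (l 0 i)%:P + 'X)) => [|i _]; last by rewrite addrC.
rewrite bigA_distr coef_sum /sigma big_distrr /= [RHS]big_mkcond /=.
apply: eq_bigr => S _.
rewrite big_if /= -(@big_mkcondr _ _ _ _ _ _ predT) /=.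
rewrite prodrN -rmorph_prod /= prodr_const.
have -> : #|[pred i | i \notin S]| = (n - #|S|)%N.
  by rewrite -[X in (X - _)%N]card_ord -(cardC S) addKn.
rewrite (_ : #|_| = #|S|); last by apply: eq_card => i; rewrite -!topredE /= andbT.
rewrite (eq_bigl (mem S)) => [|i]; last by rewrite -!topredE /= andbT.
rewrite -mulrA mulrA -[(-1) ^+ _](rmorph_sign (@polyC R)) -polyCM coefCM coefXn.
have Sn : (#|S| <= n)%N by rewrite -[X in (_ <= X)%N]card_ord max_card.
have -> : (n - j == n - #|S|)%N = (#|S| == j).
  by apply/eqP/eqP => [nj|->//]; rewrite -(subKn jn) nj subKn.
by case: eqP => [->|_]; rewrite ?mulr1 ?mulr0.
Qed.

Lemma sigma_eq l h : \prod_i ('X - (l 0 i)%:P) = \prod_i ('X - (h 0 i)%:P) ->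
  forall j, sigma j l = sigma j h.
Proof.
move=> lh j; have [nj|jn] := ltnP n j; first by rewrite !sigma_gt.
have := coef_prod_sigma l jn; rewrite lh coef_prod_sigma // => /esym.
by apply: mulfI; rewrite signr_eq0.
Qed.

(** Newton's inequality, without its binomial factors.  It holds for all real
vectors, whatever their signs: the derivative of order n - j - 1 of the monic
polynomial with roots l still splits, and its three lowest coefficients are
multiples of sigma of orders j + 1, j and j - 1. *)
Lemma newton_sigma l j : (0 < j)%N ->
  sigma j.-1 l * sigma j.+1 l <= sigma j l ^+ 2.
Proof.
case: j => // j _ /=.
have [nj|jn] := ltnP n j.+2; first by rewrite (sigma_gt _ nj) mulr0 sqr_ge0.
(* The derivative of order m of p has degree j + 2, and sigma_(j+2) as its
   constant term up to sign and a factorial. *)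
pose p := \prod_i ('X - (l 0 i)%:P); pose m := (n - j.+2)%N.
have psplit : splits p.
  exists 1, [seq l 0 i | i <- index_enum 'I_n].
  by rewrite scale1r big_map.
have := laguerre 0 (splits_derivn m psplit).
rewrite !horner_coef0 coef_deriv !coef_derivn !addn0 mulr1n.
have c i : (i <= 2)%N ->
    p`_(m + i) = (-1) ^+ (j.+2 - i) * sigma (j.+2 - i) l.
  by move=> i2; rewrite -coef_prod_sigma; [congr (_`_ _); rewrite /m|]; lia.
have := c 0%N isT; rewrite addn0 => ->; rewrite (c 1%N) // (c 2%N) //.
rewrite !subSS !subn0 [(-1) ^+ j.+2]exprS [(-1) ^+ j.+1]exprS; set e : R := (-1) ^+ j.
have e2 : e ^+ 2 = 1 by rewrite sqrr_sign.
clearbody m; set a := sigma j l; set b := sigma j.+1 l; set d := sigma j.+2 l.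
have F0 : ((m ^_ m)%:R : R) > 0 by rewrite ffactnn ltr0n fact_gt0.
have F1 : ((m + 1) ^_ m = m.+1 * m ^_ m)%N.
  have := @ffact_fact (m + 1) m (leq_addr _ _).
  by rewrite ffactnn -factS addKn addn1 muln1.
have F2 : ((m + 2) ^_ m * 2 = m.+2 * (m.+1 * m ^_ m))%N.
  have := @ffact_fact (m + 2) m (leq_addr _ _).
  by rewrite ffactnn -!factS addKn addn2.
rewrite F1 (_ : 2 ^_ 2 = 2)%N // -(mulrnA _ _ 2) F2.
move: (m ^_ m) F0 => B B0; rewrite -(mulr_natr _ B) -(mulr_natr _ (m.+1 * B)) -(mulr_natr _ (m.+2 * _)) !(natrM R).
set x : R := B%:R in B0 *; have -> : m.+2%:R = m.+1%:R + 1 :> R by rewrite -natr1.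
have : (0 : R) < m.+1%:R by rewrite ltr0n.
move: (m.+1%:R : R) => y y0.
rewrite !mulN1r opprK.
rewrite (_ : e * d * x * _ = e ^+ 2 * (a * d * (y * (y + 1) * x ^+ 2))); last by ring.
rewrite (_ : (- e * _ * _) ^+ 2 = e ^+ 2 * (b ^+ 2 * (y ^+ 2 * x ^+ 2))); last by ring.
rewrite e2 !mul1r => h.
have xy : 0 < y * x ^+ 2 by rewrite mulr_gt0 // exprn_gt0.
have h1 : a * d * (y + 1) <= b ^+ 2 * y.
  rewrite -(ler_pM2r xy).
  by apply: le_trans (le_trans h _); rewrite le_eqVlt; apply/orP; left; apply/eqP; ring.
by rewrite -(ler_pM2r y0); have := sqr_ge0 b; nra.
Qed.
End Sigma.

(** * The cones Gamma_k *)

Section Cone.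
Variables (R : realType) (n : nat).
Implicit Types l h : 'rV[R]_n.

(** sigma j (zero_at i l) is sigma_j of the coordinates of l other than the i-th,
hence the derivative of sigma_(j+1) at l in the i-th coordinate; keeping n
coordinates avoids changing the dimension. *)
Definition zero_at (i : 'I_n) l : 'rV[R]_n :=
  \row_m (if m == i then 0 else l 0 m).

Lemma prod_zero_at i l : 'X * \prod_m ('X - (l 0 m)%:P) =
  ('X - (l 0 i)%:P) * \prod_m ('X - (zero_at i l 0 m)%:P).
Proof.
rewrite (bigD1 i) //= [in RHS](bigD1 i) //= mxE eqxx subr0 mulrCA.
by do 2!congr (_ * _); apply: eq_bigr => m /negbTE mi; rewrite mxE mi.
Qed.

Lemma sigma_zero_at_ge i l j : (n <= j)%N -> sigma j (zero_at i l) = 0.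
Proof.
rewrite leq_eqVlt => /orP[/eqP <-|]; last exact: sigma_gt.
apply/eqP; rewrite -(inj_eq (mulfI (negbT (signr_eq0 R n)))) mulr0.
rewrite -coef_prod_sigma // subnn -horner_coef0 horner_prod (bigD1 i) //=.
by rewrite mxE eqxx hornerXsubC subrr mul0r.
Qed.

Lemma sigma_split i l j :
  sigma j.+1 l = sigma j.+1 (zero_at i l) + l 0 i * sigma j (zero_at i l).
Proof.
have [nj|jn] := ltnP n j.+1.
  by rewrite !(sigma_gt _ nj) sigma_zero_at_ge // mulr0 addr0.
have := congr1 (fun p : {poly R} => p`_(n - j)) (prod_zero_at i l).
rewrite coefXM mulrBl coefB coefXM coefCM subn_eq0 leqNgt jn /= -subnS.
rewrite !coef_prod_sigma ?(ltnW jn) // exprS !mulN1r !mulNr.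
rewrite mulrCA -opprD -mulrDr => /oppr_inj.
by apply: mulfI; rewrite signr_eq0.
Qed.

Lemma Gamma_le j k l : (j <= k)%N -> Gamma k l -> Gamma j l.
Proof. by move=> jk g i /andP[i0 ij]; apply: g; rewrite i0 (leq_trans ij). Qed.

Lemma Gamma_sigma_gt0 j k l : (j <= k)%N -> Gamma k l -> 0 < sigma j l.
Proof. by case: j => [|j] jk g; [rewrite sigma0|apply: g]. Qed.

(** The derivatives of sigma_1, ..., sigma_(k+1) are positive in Gamma_(k+1): with
s_j = sigma j (zero_at i l), if s_j > 0 >= s_(j+1), positivity of sigma_(j+1)
and sigma_(j+2) at l forces s_j s_(j+2) > s_(j+1)^2, against Newton. *)
Lemma Gamma_zero_at i k l : Gamma k.+1 l -> Gamma k (zero_at i l).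
Proof.
move=> g; suff pos j : (j <= k)%N -> 0 < sigma j (zero_at i l).
  by move=> j /andP[_ jk]; apply: pos.
elim: j => [|j IH] jk; first by rewrite sigma0.
have s0 := IH (ltnW jk); rewrite ltNge; apply/negP => s1.
have g1 : 0 < sigma j.+1 l by apply: g; rewrite /= ltnW.
have g2 : 0 < sigma j.+2 l by apply: g.
rewrite (sigma_split i) in g1; rewrite (sigma_split i) in g2.
have := newton_sigma (zero_at i l) (ltn0Sn j) => /= N.
set a := l 0 i in g1 g2; nra.
Qed.

Lemma zero_at_delta i l t : zero_at i (l + t *: delta_mx 0 i) = zero_at i l.
Proof. by apply/rowP => m; rewrite !mxE; case: eqP => //= _; rewrite mulr0 addr0. Qed.

Lemma zero_at_delta_neq i m l t : m != i ->
  zero_at i (l + t *: delta_mx 0 m) = zero_at i l + t *: delta_mx 0 m.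
Proof.
move=> mi; apply/rowP => x; rewrite !mxE; case: eqP => //= -> /=.
by rewrite eq_sym (negbTE mi) mulr0 addr0.
Qed.

Lemma sigma_delta i l t j :
  sigma j.+1 (l + t *: delta_mx 0 i) = sigma j.+1 l + t * sigma j (zero_at i l).
Proof.
rewrite (sigma_split i) zero_at_delta [in RHS](sigma_split i) !mxE !eqxx mulr1.
by rewrite mulrDl addrA.
Qed.

(** For 0 < j <= k, sigma_j is affine in each coordinate, with positive slope in
Gamma_k. *)
Lemma Gamma_delta i k l t : 0 <= t -> Gamma k l ->
  Gamma k (l + t *: delta_mx 0 i) /\
  forall j, (j <= k)%N -> sigma j l <= sigma j (l + t *: delta_mx 0 i).
Proof.
move=> t0 g; suff mono j : (j <= k)%N -> sigma j l <= sigma j (l + t *: delta_mx 0 i).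
  split=> // j /andP[j0 jk]; apply: lt_le_trans (mono _ jk); exact: Gamma_sigma_gt0 g.
case: j => [|j] jk; first by rewrite !sigma0.
rewrite sigma_delta lerDl mulr_ge0 // ltW //.
by apply: (Gamma_sigma_gt0 (leqnn j)); apply: Gamma_zero_at; apply: Gamma_le g.
Qed.

Lemma row_sum_delta h : h = \sum_i h 0 i *: delta_mx 0 i.
Proof. by rewrite [LHS]matrix_sum_delta big_ord1. Qed.

Lemma Gamma_monotone k l h : (forall i, 0 <= h 0 i) -> Gamma k l ->
  Gamma k (l + h) /\ forall j, (j <= k)%N -> sigma j l <= sigma j (l + h).
Proof.
move=> h0 + ; rewrite (row_sum_delta h).
elim/big_rec: _ l => [|i x _ IH] l g; first by rewrite addr0.
have [g1 m1] := Gamma_delta i (h0 i) g.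
rewrite addrA; have [g2 m2] := IH _ g1.
by split=> // j jk; apply: le_trans (m1 _ jk) (m2 _ jk).
Qed.

(** sigma_(k+1) lies above its tangent in nonnegative directions: adding the
coordinates one at a time, each slope is at least the initial one, since
zero_at i l lies in Gamma_k, where sigma_k is monotone. *)
Lemma sigma_tangent k l h : (forall i, 0 <= h 0 i) -> Gamma k.+1 l ->
  sigma k.+1 l + \sum_i h 0 i * sigma k (zero_at i l) <= sigma k.+1 (l + h).
Proof.
move=> h0; rewrite {2}(row_sum_delta h).
have := index_enum_uniq 'I_n; elim: (index_enum _) l => [|i r IH] l /=.
  by rewrite !big_nil !addr0.
move=> /andP[ir ur] g; rewrite !big_cons addrA [X in _ <= sigma _ X]addrA.
have [g1 _] := Gamma_delta i (h0 i) g.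
apply: le_trans (IH _ ur g1); rewrite sigma_delta lerD2l.
rewrite big_seq [X in _ <= X]big_seq; apply: ler_sum => m mr.
rewrite ler_wpM2l // zero_at_delta_neq; last by apply: contraNneq ir => ->.
by have [_ ->] := Gamma_delta i (h0 i) (@Gamma_zero_at m _ _ g).
Qed.
End Cone.

(** * The spectral theorem for real symmetric matrices *)

Section Spectral.
Variable R : realType.

Lemma dotE n (x y : 'rV[R]_n) : x *m y^T = (dot x y)%:M.
Proof.
apply/matrixP => i j; rewrite !mxE !ord1 eqxx mulr1n.
by apply: eq_bigr => k _; rewrite mxE.
Qed.

Lemma dotC n (x y : 'rV[R]_n) : dot x y = dot y x.
Proof. by apply: eq_bigr => i _; rewrite mulrC. Qed.

Lemma dotDl n (x y z : 'rV[R]_n) : dot (x + y) z = dot x z + dot y z.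
Proof. by rewrite -big_split; apply: eq_bigr => i _; rewrite mxE mulrDl. Qed.

Lemma dotZl n a (x z : 'rV[R]_n) : dot (a *: x) z = a * dot x z.
Proof. by rewrite /dot mulr_sumr; apply: eq_bigr => i _; rewrite mxE mulrA. Qed.

Lemma dotNl n (x z : 'rV[R]_n) : dot (- x) z = - dot x z.
Proof. by rewrite -scaleN1r dotZl mulN1r. Qed.

Lemma dotDr n (x y z : 'rV[R]_n) : dot z (x + y) = dot z x + dot z y.
Proof. by rewrite dotC dotDl !(dotC z). Qed.

Lemma dotZr n a (x z : 'rV[R]_n) : dot z (a *: x) = a * dot z x.
Proof. by rewrite dotC dotZl dotC. Qed.

Lemma dotNr n (x z : 'rV[R]_n) : dot z (- x) = - dot z x.
Proof. by rewrite dotC dotNl dotC. Qed.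

Lemma dot_ge0 n (x : 'rV[R]_n) : 0 <= dot x x.
Proof. by apply: sumr_ge0 => i _; rewrite -expr2 sqr_ge0. Qed.

Lemma dot_eq0 n (x : 'rV[R]_n) : (dot x x == 0) = (x == 0).
Proof.
apply/eqP/eqP => [x0|->]; last by rewrite /dot big1 // => i _; rewrite mxE mul0r.
apply/rowP => i; rewrite mxE.
have /psumr_eq0P/(_ x0) : forall i, true -> 0 <= x 0 i * x 0 i.
  by move=> j _; rewrite -expr2 sqr_ge0.
by move=> /(_ i isT)/eqP; rewrite mulf_eq0 orbb => /eqP.
Qed.

Lemma dot_delta n (x : 'rV[R]_n) i : dot x (delta_mx 0 i) = x 0 i.
Proof.
rewrite /dot (bigD1 i) //= mxE !eqxx mulr1 big1 ?addr0 // => j /negbTE ji.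
by rewrite mxE ji andbF mulr0.
Qed.

Lemma dot_mulmx m n (x : 'rV[R]_m) (M : 'M[R]_(m, n)) (y : 'rV[R]_n) :
  dot (x *m M) y = dot x (y *m M^T).
Proof.
have /matrixP/(_ 0 0) : x *m M *m y^T = x *m (y *m M^T)^T.
  by rewrite trmx_mul trmxK mulmxA.
by rewrite !dotE !mxE !eqxx !mulr1n.
Qed.

(** Reflection in the hyperplane orthogonal to u. *)
Lemma householder_orthogonal n (u : 'rV[R]_n) : dot u u != 0 ->
  let H := 1%:M - (2 / dot u u) *: (u^T *m u) in H *m H^T = 1%:M.
Proof.
move=> uu /=; set c := 2 / dot u u.
set P := u^T *m u; have Pt : P^T = P by rewrite trmx_mul trmxK.
have PP : P *m P = dot u u *: P.
  by rewrite {1}/P -mulmxA (mulmxA u) dotE mul_scalar_mx -scalemxAr.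
have -> : (1%:M - c *: P)^T = 1%:M - c *: P.
  by apply/matrixP => i j; rewrite -[in RHS]Pt !mxE eq_sym.
rewrite mulmxBr !mulmxBl !mulmx1 mul1mx -scalemxAl -scalemxAr PP !scalerA.
rewrite (_ : _ * dot u u = c + c); last by rewrite /c; field.
by clearbody P; apply/matrixP => i j; rewrite !mxE; ring.
Qed.

(** The reflection exchanging v with the first basis vector, if they differ. *)
Lemma orthogonal_first_row n (v : 'rV[R]_n.+1) : dot v v = 1 ->
  exists H : 'M[R]_n.+1, H *m H^T = 1%:M /\ delta_mx 0 0 *m H = v.
Proof.
move=> v1; pose e : 'rV[R]_n.+1 := delta_mx 0 0.
pose u := v - e; have [u0|u0] := eqVneq u 0.
  exists 1%:M; rewrite trmx1 mul1mx mulmx1; split=> //.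
  by apply/esym/eqP; rewrite -subr_eq0 -/e -/u u0.
pose c := 2 / dot u u; have uu : dot u u != 0 by rewrite dot_eq0.
have euu : dot u u = 2 - 2 * v 0 0.
  rewrite /u !(dotDl, dotDr, dotNl, dotNr) v1 (dotC e v) !dot_delta.
  by rewrite /e mxE !eqxx /=; ring.
exists (1%:M - c *: (u^T *m u)); split; first exact: householder_orthogonal.
rewrite mulmxBr mulmx1 -scalemxAr mulmxA -/e dotE mul_scalar_mx scalerA.
have -> : c * dot e u = -1.
  rewrite /c euu dotC dot_delta !mxE !eqxx /=.
  by rewrite euu in uu; field; rewrite uu.
by rewrite scaleN1r opprK /u addrC subrK.
Qed.

(** By induction on the dimension: an orthogonal matrix whose first row is a unit
eigenvector conjugates M to a block diagonal matrix. *)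
Theorem real_spectral n (M : 'M[R]_n) : symmetric_mx M ->
  exists (O : 'M[R]_n) (l : 'rV[R]_n),
    O *m O^T = 1%:M /\ M = O^T *m diag_mx l *m O.
Proof.
elim: n M => [|n IH] M sM.
  by exists 1%:M, 0; rewrite trmx1 mul1mx; split=> //; apply/matrixP => -[].
have [l hl] := symmetric_char_poly_split sM.
have /eigenvalueP [w wM w0] : eigenvalue M (l 0 0).
  rewrite eigenvalue_root_char hl /root horner_prod (bigD1 0) //=.
  by rewrite hornerXsubC subrr mul0r.
have dw : 0 < dot w w by rewrite lt_def dot_eq0 w0 dot_ge0.
pose v := (Num.sqrt (dot w w))^-1 *: w.
have v1 : dot v v = 1.
  rewrite dotZl dotZr mulrA -invfM -expr2 sqr_sqrtr ?dot_ge0 // mulVf //.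
  by rewrite gt_eqF.
have vM : v *m M = l 0 0 *: v by rewrite -scalemxAl wM scalerA mulrC -scalerA.
have [H [HH eH]] := orthogonal_first_row v1.
have HH' : H^T *m H = 1%:M by apply: mulmx1C.
(* The first row of N is l_0 times the first basis vector. *)
pose N : 'M[R]_(1 + n) := H *m M *m H^T.
have sN : N^T = N by rewrite /N !trmx_mul trmxK sM mulmxA.
have N0 : row 0 N = l 0 0 *: delta_mx 0 0.
  rewrite rowE /N 2!mulmxA eH vM -scalemxAl; congr (_ *: _).
  by rewrite -eH -mulmxA HH mulmx1; congr delta_mx; apply: val_inj.
have Nu j : N 0 j = l 0 0 *+ (j == 0).
  have /rowP/(_ j) := N0; rewrite !mxE => ->.
  by rewrite eqxx /= mulr_natr.
have NM : H^T *m N *m H = M.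
  by rewrite /N !mulmxA HH' mul1mx -mulmxA HH' mulmx1.
clearbody N.
have [P [m [P1 PE]]] : exists (O : 'M[R]_n) (m : 'rV[R]_n),
    O *m O^T = 1%:M /\ drsubmx N = O^T *m diag_mx m *m O.
  by apply: IH; rewrite /symmetric_mx trmx_drsub sN.
have NE : N = block_mx (l 0 0)%:M 0 0 (drsubmx N).
  have ls (i : 'I_1) : lshift n i = 0 by apply: val_inj; rewrite ord1.
  have rs (i : 'I_n) : (rshift 1 i == 0) = false by [].
  rewrite -[LHS]submxK; congr block_mx; apply/matrixP => i j.
  - by rewrite !mxE !ls Nu !ord1 !eqxx.
  - by rewrite !mxE ls Nu rs.
  - by rewrite -sN !mxE ls Nu rs.
pose O2 : 'M[R]_(1 + n) := block_mx 1%:M 0 0 P.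
have O2t : O2^T = block_mx 1%:M 0 0 P^T by rewrite tr_block_mx trmx1 !trmx0.
have O21 : O2 *m O2^T = 1%:M.
  rewrite O2t mulmx_block !mulmx0 !mul0mx !addr0 !add0r mulmx1 P1.
  by rewrite -scalar_mx_block.
have N2 : N = O2^T *m diag_mx (row_mx (l 0 0)%:M m) *m O2.
  rewrite NE PE O2t diag_mx_row !mulmx_block !(mulmx0, mul0mx, addr0, add0r, mulmx1, mul1mx).
  by congr block_mx; apply/matrixP => i j; rewrite !mxE !ord1 eqxx mulr1n.
exists (O2 *m H : 'M[R]_n.+1), (row_mx (l 0 0)%:M m : 'rV[R]_n.+1); split.
  by rewrite trmx_mul mulmxA -(mulmxA O2) HH mulmx1 O21.
by rewrite -NM N2 trmx_mul !mulmxA.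
Qed.
End Spectral.

(** * Rank one perturbations *)

Section RankOne.

(** Two block triangular factorizations of the same matrix. *)
Lemma det_1_sub_mul (F : comNzRingType) n (u : 'M[F]_(n, 1)) (v : 'rV[F]_n) :
  \det (1%:M - u *m v) = 1 - (v *m u) 0 0.
Proof.
have E1 : block_mx 1%:M v u 1%:M =
    block_mx 1%:M 0 u 1%:M *m block_mx (1%:M : 'M[F]_1) v 0 (1%:M - u *m v).
  by rewrite mulmx_block !(mul1mx, mulmx1, mul0mx, mulmx0, addr0) addrC subrK.
have E2 : block_mx 1%:M v u 1%:M =
    block_mx (1%:M - v *m u : 'M[F]_1) v 0 1%:M *m block_mx 1%:M 0 u 1%:M.
  by rewrite mulmx_block !(mul1mx, mulmx1, mul0mx, mulmx0, addr0, add0r) subrK.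
have := congr1 determinant E1; rewrite E2 !det_mulmx !det_lblock !det_ublock.
by rewrite !det1 !(mul1r, mulr1) det_mx11 !mxE => <-.
Qed.

Lemma det_diag_rank1 (F : fieldType) n (d y : 'rV[F]_n) (t : F) :
  (forall i, d 0 i != 0) ->
  \det (diag_mx d - t *: (y^T *m y)) =
  \prod_i d 0 i - t * \sum_i y 0 i ^+ 2 * \prod_(m | m != i) d 0 m.
Proof.
move=> d0; pose e : 'rV[F]_n := \row_i (d 0 i)^-1.
have E : diag_mx d *m (diag_mx e *m y^T) = y^T.
  rewrite mulmxA mulmx_diag (_ : diag_mx _ = 1%:M) ?mul1mx //.
  by apply/matrixP => i j; rewrite !mxE divff.
have -> : diag_mx d - t *: (y^T *m y) =
    diag_mx d *m (1%:M - (t *: (diag_mx e *m y^T)) *m y).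
  by rewrite mulmxBr mulmx1 -scalemxAl -scalemxAr [in RHS]mulmxA E.
rewrite det_mulmx det_diag det_1_sub_mul mulrBr mulr1 -scalemxAr mxE mulrCA.
congr (_ - t * _); rewrite mxE mulr_sumr; apply: eq_bigr => i _.
rewrite mul_diag_mx !mxE (bigD1 i) //=.
by set P := \prod_(_ | _) _; field.
Qed.

Variables (R : realType) (n : nat).
Implicit Types (M : 'M[R]_n) (l y : 'rV[R]_n).

(** The determinant of a diagonal matrix plus a rank one matrix, computed in the
field of fractions, where the diagonal entries X - l_i are invertible. *)
Lemma char_poly_diag_rank1 l y (t : R) :
  char_poly (diag_mx l + t *: (y^T *m y)) = \prod_i ('X - (l 0 i)%:P) -
    t%:P * \sum_i (y 0 i ^+ 2)%:P * \prod_(m | m != i) ('X - (l 0 m)%:P).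
Proof.
apply/eqP; rewrite -tofrac_eq; apply/eqP; rewrite /char_poly -det_map_mx.
pose d : 'rV[{fraction {poly R}}]_n := \row_i tofrac ('X - (l 0 i)%:P).
pose z : 'rV[{fraction {poly R}}]_n := \row_i tofrac (y 0 i)%:P.
have -> : map_mx (@tofrac {poly R}) (char_poly_mx (diag_mx l + t *: (y^T *m y))) =
    diag_mx d - (tofrac t%:P) *: (z^T *m z).
  apply/matrixP => i j; rewrite !mxE !big_ord1 !mxE.
  rewrite -!tofracM -!polyCM -tofracMn -tofracB; congr tofrac.
  by rewrite polyCD polyCMn opprD addrA mulrnBl.
rewrite det_diag_rank1; last first.
  by move=> i; rewrite mxE tofrac_eq0 polyXsubC_eq0.
rewrite rmorphB rmorphM rmorph_sum rmorph_prod /=; congr (_ - _ * _).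
  by apply: eq_bigr => i _; rewrite mxE.
apply: eq_bigr => i _; rewrite mxE rmorphM rmorph_prod /= -!rmorphXn /=.
by congr (_ * _); apply: eq_bigr => m _; rewrite mxE.
Qed.

Lemma sigma_eigenvalues M l : char_poly M = \prod_i ('X - (l 0 i)%:P) ->
  forall j, sigma j (eigenvalues M) = sigma j l.
Proof.
move=> Ml j; apply: sigma_eq; rewrite /eigenvalues.
by case: xgetP => [v _ <-|/(_ l)].
Qed.

Lemma char_poly_orthogonal (O M : 'M[R]_n) : O *m O^T = 1%:M ->
  char_poly (O^T *m M *m O) = char_poly M.
Proof.
move=> OO; have /mulmx1_unit[uO _] := OO.
have -> : O^T = invmx O by rewrite -[RHS]mulmx1 -OO mulKmx.
exact: char_poly_conj.
Qed.

(** A rank one term acts on sigma_(j+1) linearly, through the derivatives of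
sigma_(j+1) at the diagonal part. *)
Lemma sigma_diag_rank1 l y (t : R) j :
  sigma j.+1 (eigenvalues (diag_mx l + t *: (y^T *m y))) =
  sigma j.+1 l + t * \sum_i y 0 i ^+ 2 * sigma j (zero_at i l).
Proof.
set N := diag_mx l + _.
have sN : symmetric_mx N.
  apply/matrixP => a b; rewrite !mxE !big_ord1 !mxE eq_sym.
  by congr (_ + _ * _); [case: eqP => // -> | rewrite mulrC].
have [nj|jn] := ltnP n j.+1.
  rewrite !(sigma_gt _ nj) big1 ?mulr0 ?addr0 // => i _.
  by rewrite sigma_zero_at_ge // mulr0.
have := congr1 (fun p : {poly R} => p`_(n - j.+1)) (char_poly_diag_rank1 l y t).
rewrite (eigenvaluesP sN) coefB coefCM coef_sum !coef_prod_sigma // exprS mulN1r !mulNr.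
have -> : \sum_i ((y 0 i ^+ 2)%:P * \prod_(m | m != i) ('X - (l 0 m)%:P))`_(n - j.+1) =
    (-1) ^+ j * \sum_i y 0 i ^+ 2 * sigma j (zero_at i l).
  rewrite mulr_sumr; apply: eq_bigr => i _; rewrite coefCM mulrCA; congr (_ * _).
  rewrite -coef_prod_sigma 1?ltnW // [in RHS](bigD1 i) //= mxE eqxx subr0 coefXM subn_eq0.
  rewrite leqNgt jn /= -subnS; congr (polyseq _)`__.
  by apply: eq_bigr => m /negbTE mi; rewrite mxE mi.
rewrite mulrCA -opprD -mulrDr => /oppr_inj.
by apply: mulfI; rewrite signr_eq0.
Qed.

Lemma symmetric_rank1 M y (t : R) : symmetric_mx M -> symmetric_mx (M + t *: (y^T *m y)).
Proof.
move=> sM; apply/matrixP => a b; rewrite !mxE !big_ord1 !mxE.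
by congr (_ + _ * _); [rewrite -{1}sM mxE | rewrite mulrC].
Qed.

(** The vector l lists the eigenvalues of M and y holds the coordinates of v in an
orthonormal eigenbasis of M; neither depends on t. *)
Lemma eigenvalues_rank1 M (v : 'rV[R]_n) : symmetric_mx M -> exists y l,
  [/\ dot y y = dot v v, forall j, sigma j (eigenvalues M) = sigma j l &
    forall t j, sigma j.+1 (eigenvalues (M + t *: (v^T *m v))) =
      sigma j.+1 l + t * \sum_i y 0 i ^+ 2 * sigma j (zero_at i l)].
Proof.
move=> /real_spectral [U [l [UU ME]]]; exists (v *m U^T), l.
have UtU : U^T *m U = 1%:M by apply: mulmx1C.
split.
- by rewrite dot_mulmx trmxK -mulmxA UtU mulmx1.
- apply: sigma_eigenvalues; rewrite ME char_poly_orthogonal //.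
  by rewrite char_poly_trig ?diag_mx_is_trig //; apply: eq_bigr => i _; rewrite mxE eqxx.
move=> t j; rewrite -sigma_diag_rank1; apply: sigma_eigenvalues.
rewrite -eigenvaluesP; last by apply: symmetric_rank1; rewrite /symmetric_mx tr_diag_mx.
rewrite -[RHS](char_poly_orthogonal _ UU); congr char_poly.
rewrite mulmxDr mulmxDl -ME -scalemxAr -scalemxAl trmx_mul trmxK !mulmxA UtU mul1mx.
by rewrite -!mulmxA UtU mulmx1.
Qed.

Lemma Gamma_rank1 k M (v : 'rV[R]_n) (t : R) : symmetric_mx M -> Gamma k (eigenvalues M) -> 0 <= t ->
  Gamma k (eigenvalues (M + t *: (v^T *m v))) /\
  (forall j, (j <= k)%N -> sigma j (eigenvalues M) <= sigma j (eigenvalues (M + t *: (v^T *m v)))).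
Proof.
move=> sM g t0; have [y [l [_ Ml /(_ t)]]] := eigenvalues_rank1 v sM.
move: (eigenvalues (M + _)) (eigenvalues M) g Ml => e e0 g Ml Me.
suff mono j : (j <= k)%N -> sigma j e0 <= sigma j e.
  by split=> // j /andP[j0 jk]; apply: lt_le_trans (mono _ jk); apply: Gamma_sigma_gt0 g.
case: j => [|j] jk; first by rewrite !sigma0.
rewrite Me Ml lerDl mulr_ge0 //.
apply: sumr_ge0 => i _; rewrite mulr_ge0 ?sqr_ge0 // ltW //.
apply: (Gamma_sigma_gt0 (leqnn j)); apply: Gamma_zero_at; apply: Gamma_le jk _.
by move=> m /g; rewrite Ml.
Qed.

Lemma sigma_rank1_lt k M (v : 'rV[R]_n) (t : R) : symmetric_mx M -> Gamma k.+1 (eigenvalues M) ->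
  0 < t -> v != 0 ->
  sigma k.+1 (eigenvalues M) < sigma k.+1 (eigenvalues (M + t *: (v^T *m v))).
Proof.
move=> sM g t0 v0; have [y [l [yv Ml /(_ t k)]]] := eigenvalues_rank1 v sM.
move: (eigenvalues (M + _)) (eigenvalues M) g Ml => e e0 g Ml ->.
have pos i : 0 < sigma k (zero_at i l).
  apply: (Gamma_sigma_gt0 (leqnn k)); apply: Gamma_zero_at.
  by move=> m /g; rewrite Ml.
rewrite Ml ltrDl mulr_gt0 //.
have S0 i : true -> 0 <= y 0 i ^+ 2 * sigma k (zero_at i l).
  by rewrite mulr_ge0 ?sqr_ge0 ?ltW.
rewrite lt_def sumr_ge0 // andbT; apply: contra v0 => /eqP s0.
rewrite -dot_eq0 -yv dot_eq0; apply/eqP/rowP => i; rewrite mxE.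
have /eqP := psumr_eq0P S0 s0 (isT : (fun=> true) i).
by rewrite mulf_eq0 [_ == 0 as X in _ || X]gt_eqF ?pos // orbF sqrf_eq0 => /eqP.
Qed.
End RankOne.

(** * Monotonicity of sigma_k on symmetric matrices *)

Section Matrices.
Variables (R : realType) (n : nat).
Implicit Types (M N : 'M[R]_n) (l y v : 'rV[R]_n).

Lemma orthogonal_row_dot (U : 'M[R]_n) i : U *m U^T = 1%:M ->
  dot (row i U) (row i U) = 1.
Proof.
move=> /matrixP/(_ i i); rewrite !mxE eqxx mulr1n => <-.
by apply: eq_bigr => j _; rewrite !mxE.
Qed.

Lemma spectral_sum (U : 'M[R]_n) l :
  U^T *m diag_mx l *m U = \sum_i l 0 i *: ((row i U)^T *m row i U).
Proof.
apply/matrixP => a b; rewrite mxE summxE; apply: eq_bigr => i _.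
by rewrite mul_mx_diag !mxE big_ord1 !mxE; ring.
Qed.

(** The spectral decomposition writes a positive semidefinite matrix as a sum of
positive rank one terms. *)
Lemma symmetric_psd_sum M : symmetric_mx M -> (forall v, 0 <= dot (v *m M) v) ->
  exists (U : 'M[R]_n) l, (forall i, 0 <= l 0 i) /\
    M = \sum_i l 0 i *: ((row i U)^T *m row i U).
Proof.
move=> /real_spectral [U [l [UU ME]]] psd; exists U, l; rewrite -spectral_sum.
split=> // i; have := psd (row i U).
have -> : row i U *m M = l 0 i *: row i U.
  rewrite ME !mulmxA rowE -(mulmxA _ U) UU mulmx1.
  by rewrite -rowE row_diag_mx -scalemxAl.
by rewrite dotZl orthogonal_row_dot // mulr1.
Qed.

(** Degenerate ellipticity of the equation on k-admissible matrices, one rank one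
term at a time. *)
Lemma Gamma_psd k M N : symmetric_mx M -> symmetric_mx N ->
  (forall v, 0 <= dot (v *m (N - M)) v) -> Gamma k (eigenvalues M) ->
  Gamma k (eigenvalues N) /\
  forall j, (j <= k)%N -> sigma j (eigenvalues M) <= sigma j (eigenvalues N).
Proof.
move=> sM sN /symmetric_psd_sum [|U [l [l0 NM]]].
  by rewrite /symmetric_mx raddfB /= sM sN.
have -> : N = M + \sum_i l 0 i *: ((row i U)^T *m row i U) by rewrite -NM addrC subrK.
elim/big_rec: _ M sM {N sN NM} => [|i x _ IH] M sM g; first by rewrite addr0.
have [g1 m1] := Gamma_rank1 (row i U) sM g (l0 i).
rewrite addrA; have [g2 m2] := IH _ (symmetric_rank1 (row i U) (l 0 i) sM) g1.
by split=> [|j jk]; [exact: g2 | exact: le_trans (m1 _ jk) (m2 _ jk)].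
Qed.

(** The strict form that the comparison principles need: e I exceeds a
nonzero rank one matrix. *)
Lemma sigma_add_scalar_lt k M (e : R) : symmetric_mx M ->
  Gamma k.+1 (eigenvalues M) -> 0 < e ->
  Gamma k.+1 (eigenvalues (M + e%:M)) /\
  sigma k.+1 (eigenvalues M) < sigma k.+1 (eigenvalues (M + e%:M)).
Proof.
move=> sM g e0.
have n0 : (0 < n)%N.
  by rewrite lt0n; apply/eqP => n0; have := g 1%N isT; rewrite sigma_gt ?n0 ?ltxx.
pose v : 'rV[R]_n := delta_mx 0 (Ordinal n0).
have v0 : v != 0.
  apply/eqP => /rowP/(_ (Ordinal n0))/eqP; rewrite !mxE !eqxx /=.
  by rewrite oner_eq0.
have lt := sigma_rank1_lt sM g e0 v0.
have sM1 := symmetric_rank1 v e sM.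
have [g1 _] := Gamma_rank1 v sM g (ltW e0).
have sE : symmetric_mx (M + e%:M) by rewrite /symmetric_mx raddfD /= sM tr_scalar_mx.
have [|g2 m2] := @Gamma_psd k.+1 _ (M + e%:M) sM1 sE _ g1; last first.
  by split; [exact: g2 | exact: lt_le_trans lt (m2 _ (leqnn _))].
move=> w; rewrite opprD addrACA subrr add0r mulmxBr mul_mx_scalar -scalemxAr.
rewrite mulmxA dotE mul_scalar_mx dotDl dotNl !dotZl -mulrBr mulr_ge0 ?(ltW e0) //.
rewrite dot_delta (dotC v) dot_delta /dot (bigD1 (Ordinal n0)) //= addrC addrK.
by apply: sumr_ge0 => i _; rewrite -expr2 sqr_ge0.
Qed.

(** The polynomial t |-> sigma j (l + t h). *)
Definition sigma_line (l h : 'rV[R]_n) (j : nat) : {poly R} :=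
  \sum_(S : {set 'I_n} | #|S| == j) \prod_(i in S) ((l 0 i)%:P + (h 0 i)%:P * 'X).

Lemma sigma_lineE l h j t : (sigma_line l h j).[t] = sigma j (l + t *: h).
Proof.
rewrite horner_sum; apply: eq_bigr => S _; rewrite horner_prod.
by apply: eq_bigr => i _; rewrite !hornerE !mxE mulrC.
Qed.

(** A Lipschitz constant at 0 on the interval [0, 1]. *)
Definition poly_lip (p : {poly R}) : R := \sum_(i < size p) `|p`_i|.

Lemma poly_lipP (p : {poly R}) t : 0 <= t <= 1 ->
  `|p.[t] - p.[0]| <= poly_lip p * t.
Proof.
move=> /andP[t0 t1]; rewrite !horner_coef -sumrB mulr_suml.
apply: le_trans (ler_norm_sum _ _ _) _; apply: ler_sum => i _.
rewrite -mulrBr normrM ler_wpM2l // expr0n.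
case: (nat_of_ord i) => [|m] /=; first by rewrite expr0 subrr normr0.
by rewrite subr0 ger0_norm ?exprn_ge0 // exprS ler_piMr // exprn_ile1.
Qed.

Lemma poly_lip_ge0 (p : {poly R}) : 0 <= poly_lip p.
Proof. by apply: sumr_ge0 => i _. Qed.
End Matrices.

(** * The algebra of the barrier *)

Section BarrierAlgebra.
Variables (R : realType) (n : nat).
Implicit Types (M N : 'M[R]_n) (l h y v : 'rV[R]_n).

Lemma zero_at_add_scale i l h (t : R) :
  zero_at i (l + t *: h) = zero_at i l + t *: zero_at i h.
Proof. by apply/rowP => m; rewrite !mxE; case: ifP; rewrite ?mulr0 ?addr0. Qed.

Lemma ler_sum_term (I : finType) (F : I -> R) i :
  (forall j, 0 <= F j) -> F i <= \sum_j F j.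
Proof. by move=> F0; rewrite (bigD1 i) //= lerDl sumr_ge0. Qed.

Lemma sigma_zero_at_lip l h k : exists2 K : R, 0 <= K &
  forall t, 0 <= t <= 1 -> forall i j, (j < k)%N ->
    `|sigma j (zero_at i (l + t *: h)) - sigma j (zero_at i l)| <= K * t.
Proof.
pose F (ij : 'I_n * 'I_k) :=
  poly_lip (sigma_line (zero_at ij.1 l) (zero_at ij.1 h) ij.2).
have F0 ij : 0 <= F ij by apply: poly_lip_ge0.
exists (\sum_ij F ij); first by apply: sumr_ge0.
move=> t t01 i j jk; rewrite zero_at_add_scale.
have := poly_lipP (sigma_line (zero_at i l) (zero_at i h) j) t01.
rewrite !sigma_lineE scale0r addr0 => /le_trans; apply.
rewrite ler_wpM2r //; first by case/andP: t01.
exact: (@ler_sum_term _ F (i, Ordinal jk)).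
Qed.

Lemma sigma_zero_at_bound l h k : exists2 K : R, 0 <= K &
  forall t, 0 <= t <= 1 -> forall i j, (j < k)%N ->
    sigma j (zero_at i (l + t *: h)) <= K.
Proof.
have [K K0 hK] := sigma_zero_at_lip l h k.
pose F (ij : 'I_n * 'I_k) := `|sigma ij.2 (zero_at ij.1 l)|.
exists (\sum_ij F ij + K); first by rewrite addr_ge0 ?sumr_ge0 // => ij _; apply: normr_ge0.
move=> t t01 i j jk.
have := hK t t01 i j jk; have /andP[t0 t1] := t01.
have := @ler_sum_term _ F (i, Ordinal jk) (fun ij => normr_ge0 _).
rewrite {1}/F /= => b; rewrite ler_norml => /andP[_].
have := ler_norm (sigma j (zero_at i l)); have : K * t <= K by rewrite ler_piMr.
lra.
Qed.

(** The inverse of a sum of inverses serves as a minimum of the sigma_j. *)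
Lemma Gamma_uniform_lower_bound k l : Gamma k l ->
  exists2 m : R, 0 < m & forall j, (1 <= j <= k)%N -> m <= sigma j l.
Proof.
move=> g; pose F (j : 'I_k) := (sigma j.+1 l)^-1.
have F0 j : 0 < F j by rewrite invr_gt0 g //= ltn_ord.
exists (1 + \sum_j F j)^-1.
  by rewrite invr_gt0 ltr_wpDr // sumr_ge0 // => j _; apply: ltW.
case=> [//|j] /= jk; rewrite -[leRHS]invrK lef_pV2 ?posrE ?invr_gt0 ?g //.
  apply: le_trans (@ler_sum_term _ F (Ordinal jk) (fun j => ltW (F0 j))) _.
  by rewrite lerDr.
by rewrite ltr_wpDr // sumr_ge0 // => i _; apply: ltW.
Qed.

(** The vector e stands for the eigenvalues of diag (l + p be) - q y^T y.  The
product of a i = d sigma_(k+1) / d l_i with be_i is 1, so the first order term in p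
is n p and the first order term in q is q s.  The part of order p is bounded
below by the tangent inequality without any error; the only error comes from
evaluating the derivatives at l + p be instead of l, and it is of order p q s, hence
of order p^2.  So a gain n p - q s of order p^2 suffices for sigma_(k+1) >= 1,
and the smallness of p keeps the lower sigma_j positive. *)
Lemma barrier_diag k l (L : R) : Gamma k.+1 l -> sigma k.+1 l = 1 -> 0 <= L ->
  let a i := sigma k (zero_at i l) in
  let be : 'rV[R]_n := \row_i (a i)^-1 in
  exists K d : R, [/\ 0 <= K, 0 < d & forall (p q : R) y,
    0 <= p <= d -> 0 <= q ->
    let s := \sum_i a i * y 0 i ^+ 2 in
    q * s <= L * p -> K * p ^+ 2 <= n%:R * p - q * s ->
    forall e : 'rV[R]_n, (forall j, sigma j.+1 e = sigma j.+1 (l + p *: be) +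
       - q * \sum_i y 0 i ^+ 2 * sigma j (zero_at i (l + p *: be))) ->
    Gamma k.+1 e /\ 1 <= sigma k.+1 e].
Proof.
move=> g s1 L0 a be.
have a0 i : 0 < a i by apply: (Gamma_sigma_gt0 (leqnn k)); apply: Gamma_zero_at.
pose b1 := \sum_i be 0 i.
have be0 i : 0 <= be 0 i by rewrite mxE invr_ge0 ltW.
have b10 : 0 <= b1 by apply: sumr_ge0.
have [K1 K10 lip] := sigma_zero_at_lip l be k.+1.
have [K2 K20 bnd] := sigma_zero_at_bound l be k.+1.
have [m m0 pos] := Gamma_uniform_lower_bound g.
have BL : 0 <= b1 * L * K2 by rewrite !mulr_ge0.
exists (K1 * (b1 * L)), (Num.min 1 (m / (b1 * L * K2 + 1))); split.
- by rewrite !mulr_ge0.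
- by rewrite lt_min ltr01 divr_gt0 // ltr_wpDl.
move=> p q y /andP[p0]; rewrite le_min => /andP[p1 pd] q0 s qs hp e He.
have p01 : 0 <= p <= 1 by rewrite p0.
(* q |y|^2 is of order p, since q s is and a is bounded below. *)
have W : q * \sum_i y 0 i ^+ 2 <= b1 * L * p.
  rewrite -mulrA; apply: le_trans (ler_wpM2l b10 qs).
  rewrite /s !mulr_sumr; apply: ler_sum => i _.
  have -> : q * y 0 i ^+ 2 = be 0 i * (q * (a i * y 0 i ^+ 2)).
    by rewrite mxE; field; rewrite gt_eqF.
  rewrite ler_wpM2r ?(ler_sum_term _ be0) //.
  by rewrite (mulr_ge0 q0) // (mulr_ge0 (ltW (a0 i))) // sqr_ge0.
have W0 : 0 <= q * \sum_i y 0 i ^+ 2 by rewrite mulr_ge0 // sumr_ge0 // => i _; apply: sqr_ge0.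
have pbe0 i : 0 <= (p *: be) 0 i by rewrite mxE mulr_ge0.
have sk : 1 <= sigma k.+1 e.
  rewrite He.
  have h1 : 1 + n%:R * p <= sigma k.+1 (l + p *: be).
    apply: le_trans (sigma_tangent pbe0 g); rewrite s1 lerD2l.
    rewrite (eq_bigr (fun=> p)) => [|i _]; last first.
      by rewrite !mxE -/(a i) mulfVK // gt_eqF.
    by rewrite sumr_const card_ord mulr_natl.
  have h2 : q * \sum_i y 0 i ^+ 2 * sigma k (zero_at i (l + p *: be)) <=
      q * s + K1 * p * (b1 * L * p).
    apply: le_trans (_ : q * s + K1 * p * (q * \sum_i y 0 i ^+ 2) <= _); last first.
      by rewrite lerD2l ler_wpM2l // mulr_ge0.
    rewrite [K1 * p * _]mulrCA -mulrDr ler_wpM2l // mulr_sumr -big_split /=.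
    apply: ler_sum => i _; rewrite [a i * _]mulrC [K1 * p * _]mulrC -mulrDr.
    rewrite ler_wpM2l ?sqr_ge0 //.
    have := lip p p01 i k (ltnSn k); rewrite ler_norml => /andP[_].
    by rewrite lerBlDl.
  have -> : 1 = 1 + n%:R * p - (q * s + (n%:R * p - q * s)) :> R by ring.
  rewrite mulNr lerB //; apply: le_trans h2 _; rewrite lerD2l.
  by apply: le_trans hp; rewrite le_eqVlt; apply/orP; left; apply/eqP; ring.
split=> // j /andP[]; case: j => // j _ jk.
move: jk; rewrite leq_eqVlt => /orP[/eqP ->|jk]; first exact: lt_le_trans sk.
rewrite He mulNr subr_gt0.
have [_ mono] := Gamma_monotone pbe0 g.
apply: lt_le_trans (mono _ (ltnW jk)).
apply: lt_le_trans (pos j.+1 (ltnW jk)).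
apply: le_lt_trans (_ : b1 * L * K2 * p < _).
  apply: le_trans (_ : K2 * (q * \sum_i y 0 i ^+ 2) <= _).
    rewrite mulrCA ler_wpM2l // mulr_sumr; apply: ler_sum => i _.
    by rewrite [K2 * _]mulrC ler_wpM2l ?sqr_ge0 // bnd // ltnW.
  by rewrite [leRHS]mulrAC [leRHS]mulrC ler_wpM2l.
have D0 : 0 < b1 * L * K2 + 1 by rewrite ltr_wpDl.
move: pd; rewrite ler_pdivlMr // mulrC mulrDl mul1r => pd.
move: p0; rewrite le_eqVlt => /orP[/eqP <-|p0]; first by rewrite mulr0.
by apply: lt_le_trans pd; rewrite ltrDl.
Qed.

Lemma orthogonal_dot (U : 'M[R]_n) (x : 'rV[R]_n) : U *m U^T = 1%:M ->
  dot (x *m U^T) (x *m U^T) = dot x x.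
Proof.
move=> UU; have UtU : U^T *m U = 1%:M by apply: mulmx1C.
by rewrite dot_mulmx trmxK -mulmxA UtU mulmx1.
Qed.

(** B is the inverse of the coefficient matrix of the operator linearized at A:
both are diagonal in an eigenbasis of A, with entries be_i and a i = 1 / be_i. *)
Lemma barrier_matrix k (A : 'M[R]_n) (L : R) : (0 < n)%N -> calA k.+1 A -> 0 <= L ->
  exists (B : 'M[R]_n) (b0 b1 K d : R),
  [/\ symmetric_mx B, 0 < b0, 0 <= K, 0 < d &
    (forall x, b0 * dot x x <= dot (x *m B) x <= b1 * dot x x) /\
    forall p q x, 0 <= p <= d -> 0 <= q ->
      let s := dot (x *m B) x in
      q * s <= L * p -> K * p ^+ 2 <= n%:R * p - q * s ->
      let H := A + p *: B - q *: ((x *m B)^T *m (x *m B)) in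
      Gamma k.+1 (eigenvalues H) /\ 1 <= sigma k.+1 (eigenvalues H)].
Proof.
move=> n0 [sA gA sA1] L0.
have [U [l [UU AE]]] := real_spectral sA.
have Al j : sigma j (eigenvalues A) = sigma j l.
  apply: sigma_eigenvalues; rewrite AE char_poly_orthogonal //.
  by rewrite char_poly_trig ?diag_mx_is_trig //; apply: eq_bigr => i _; rewrite mxE eqxx.
have g : Gamma k.+1 l by move=> j /gA; rewrite Al.
have s1 : sigma k.+1 l = 1 by rewrite -Al.
pose a i := sigma k (zero_at i l).
pose be : 'rV[R]_n := \row_i (a i)^-1.
have a0 i : 0 < a i by apply: (Gamma_sigma_gt0 (leqnn k)); apply: Gamma_zero_at.
have be0 i : 0 < be 0 i by rewrite mxE invr_gt0.
have [K [d [K0 d0 key]]] := barrier_diag g s1 L0.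
pose B := U^T *m diag_mx be *m U.
have sB : symmetric_mx B by rewrite /symmetric_mx /B !trmx_mul trmxK tr_diag_mx mulmxA.
have xB (x : 'rV[R]_n) : x *m B = (x *m U^T *m diag_mx be) *m U by rewrite /B !mulmxA.
have sE (x : 'rV[R]_n) : dot (x *m B) x = \sum_i be 0 i * (x *m U^T) 0 i ^+ 2.
  rewrite xB dot_mulmx; apply: eq_bigr => i _.
  by rewrite mul_mx_diag mxE; ring.
have sa : 0 < \sum_i a i.
  rewrite (bigD1 (Ordinal n0)) //= ltr_wpDr // sumr_ge0 // => i _.
  exact: ltW.
have be_le i : be 0 i <= \sum_i be 0 i.
  by apply: (@ler_sum_term _ (fun i => be 0 i)) => j; apply: ltW.
have be_ge i : (\sum_i a i)^-1 <= be 0 i.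
  rewrite mxE lef_pV2 ?posrE //.
  by apply: (@ler_sum_term _ a) => j; apply: ltW.
exists B, (\sum_i a i)^-1, (\sum_i be 0 i), K, d.
split; [exact: sB | by rewrite invr_gt0 | exact: K0 | exact: d0 |].
split.
  move=> x; rewrite sE -(orthogonal_dot x UU) /dot !mulr_sumr.
  apply/andP; split; apply: ler_sum => i _; rewrite -expr2 ler_wpM2r ?sqr_ge0 //.
move=> p q x pd q0 s qs hp H.
pose y := x *m U^T *m diag_mx be.
have sy : s = \sum_i a i * y 0 i ^+ 2.
  rewrite /s sE; apply: eq_bigr => i _.
  have -> : y 0 i = be 0 i * (x *m U^T) 0 i by rewrite /y mul_mx_diag mxE mulrC.
  by move: ((x *m U^T) 0 i) => z; rewrite mxE; field; rewrite gt_eqF.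
rewrite sy in qs hp.
apply: (key p q y) => // j; rewrite -sigma_diag_rank1; apply: sigma_eigenvalues.
rewrite -eigenvaluesP; last by apply: symmetric_rank1; rewrite /symmetric_mx tr_diag_mx.
rewrite -[RHS](char_poly_orthogonal _ UU); congr char_poly.
rewrite /H AE xB -/y trmx_mul mulmxDr mulmxDl [diag_mx (l + _)]raddfD /=.
rewrite mulmxDr mulmxDl; congr (_ + _ + _).
  by rewrite /B linearZ /= -scalemxAr -scalemxAl.
by rewrite -scalemxAr -scalemxAl scaleNr !mulmxA.
Qed.
End BarrierAlgebra.

(** * Functions of class C^2 with explicit derivatives *)

Section Calculus.
Variable R : realType.

Lemma near_eq_differentiable (V W : normedModType R) (f g : V -> W) (x : V) :
  (\near x, f x = g x) -> differentiable f x -> differentiable g x.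
Proof.
move=> fg df; have fgx : f x = g x by apply: nbhs_singleton fg.
have H : g \o shift x = cst (g x) + 'd f x +o_ 0 id.
  apply/eqaddoP => e e0; have /diff_locally/eqaddoP/(_ e e0) Hf := df.
  have fg0 : \forall y \near 0, f (y + x) = g (y + x).
    by have := fg; rewrite (near_shift 0 x); apply: filterS => y /=; rewrite subr0.
  apply: filterS2 Hf fg0 => y.
  by rewrite -[X in X <= _ -> _]/(`|f (y + x) - (f x + 'd f x y)|) fgx => + fgy; rewrite fgy.
by apply/diff_locallyP; rewrite (diff_unique (diff_continuous df) H); split=> //; apply: diff_continuous.
Qed.

Variable n : nat.
Implicit Types (f : 'rV[R]_n -> R) (U : set 'rV[R]_n).

(** f is of class C^2 on U with gradient g and Hessian H; unlike iterated partial
derivatives, these data can be given by formulas. *)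
Definition C2_data U f (g : 'rV[R]_n -> 'rV[R]_n) (H : 'rV[R]_n -> 'M[R]_n) :=
  forall x, U x ->
  [/\ differentiable f x, forall v, 'D_v f x = dot (g x) v,
     forall i, differentiable (fun x => g x 0 i : R) x,
     forall i v, 'D_v (fun x => g x 0 i : R) x = (v *m H x) 0 i &
     forall i j, {for x, continuous (fun x => H x i j : R)}].

Lemma C2_data_partial1 U f g H i x : C2_data U f g H -> U x ->
  partial [:: i] f x = g x 0 i.
Proof. by move=> h /h [_ D _ _ _]; rewrite /partial /= D dot_delta. Qed.

Lemma C2_data_partial2 U f g H i j x : open U -> C2_data U f g H -> U x ->
  partial [:: i; j] f x = H x i j.
Proof.
move=> oU h Ux; rewrite /partial /=.
rewrite (@near_eq_derive _ _ _ _ (fun x => g x 0 j : R)); last first.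
  have := open_nbhs_nbhs (conj oU Ux); apply: filterS => y Uy.
  exact: (C2_data_partial1 j h Uy).
by have [_ _ _ -> _] := h _ Ux; rewrite -rowE mxE.
Qed.

Lemma C2_data_hessian U f g H x : open U -> C2_data U f g H -> U x ->
  hessian f x = H x.
Proof. by move=> oU h Ux; apply/matrixP => i j; rewrite mxE (C2_data_partial2 _ _ oU h). Qed.

Lemma near_eq_continuous (f h : 'rV[R]_n -> R) x : (\near x, f x = h x) ->
  {for x, continuous f} -> {for x, continuous h}.
Proof.
move=> fh; have fhx : f x = h x by apply: nbhs_singleton fh.
rewrite /prop_for /continuous_at -fhx => cf.
by apply: cvg_trans cf; exact: (@near_eq_cvg _ _ (nbhs x) _ f h fh).
Qed.

Lemma C2_data_class_C U f g H : open U -> C2_data U f g H -> class_C 2 U f.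
Proof.
move=> oU h s x Ux; have nU := open_nbhs_nbhs (conj oU Ux).
have [d0 _ d1 _ c2] := h _ Ux.
have d1' i : differentiable (partial [:: i] f) x.
  apply: near_eq_differentiable (d1 i); apply: filterS nU => y Uy.
  exact/esym/(C2_data_partial1 i h Uy).
case: s => [|i [|j [|]]] //=.
- by split=> _ //; apply: differentiable_continuous.
- by split=> _; [apply: (differentiable_continuous (d1' i)) | exact: d1'].
split=> // _; apply: near_eq_continuous (c2 i j).
by apply: filterS nU => y Uy; apply/esym/(C2_data_partial2 i j oU h Uy).
Qed.
End Calculus.

(** * Rules of differentiation *)

Section Directional.
Variables (R : realType) (n : nat).
Implicit Types (f g : 'rV[R]_n -> R) (x v : 'rV[R]_n).

(** df is the differential of f at x, so that the rules below transport
differentiability and the value of all directional derivatives together. *)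
Definition has_diff f x (df : 'rV[R]_n -> R) :=
  differentiable f x /\ forall v, 'D_v f x = df v.

Lemma has_diff_ext f g x df dg : f =1 g -> df =1 dg ->
  has_diff f x df -> has_diff g x dg.
Proof. by move=> /funext <- /funext <-. Qed.

Lemma has_diff_cst c x : has_diff (fun=> c) x (fun=> 0).
Proof. by split=> [|v]; [exact: differentiable_cst | exact: derive_cst]. Qed.

Lemma has_diff_coord i x : has_diff (fun y => y 0 i) x (fun v => v 0 i).
Proof.
split; first exact: differentiable_coord.
move=> v.
have did : derivable (@id 'rV[R]_n) x v by exact: derivable_id.
have -> : 'D_v (fun y : 'rV[R]_n => y 0 i) x = ('D_v id x : 'rV[R]_n) 0 i.
  by rewrite (derive_mx did) mxE.
by rewrite derive_id.
Qed.

Lemma has_diffD f g x df dg : has_diff f x df -> has_diff g x dg ->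
  has_diff (fun y => f y + g y) x (fun v => df v + dg v).
Proof.
move=> [f1 f2] [g1 g2]; split=> [|v]; first exact: differentiableD.
by rewrite (@deriveD _ _ _ f g) ?f2 ?g2 //; exact: diff_derivable.
Qed.

Lemma has_diffM f g x df dg : has_diff f x df -> has_diff g x dg ->
  has_diff (fun y => f y * g y) x (fun v => f x * dg v + g x * df v).
Proof.
move=> [f1 f2] [g1 g2]; split=> [|v]; first exact: differentiableM.
by rewrite (@deriveM _ _ f g) ?f2 ?g2 //; exact: diff_derivable.
Qed.

Lemma has_diffZ c f x df : has_diff f x df ->
  has_diff (fun y => c * f y) x (fun v => c * df v).
Proof.
move=> h; apply: has_diff_ext (has_diffM (has_diff_cst c x) h) => // v.
by rewrite mulr0 addr0.
Qed.

Lemma has_diff_sum m (f : 'I_m -> 'rV[R]_n -> R) x df :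
  (forall i, has_diff (f i) x (df i)) ->
  has_diff (fun y => \sum_i f i y) x (fun v => \sum_i df i v).
Proof.
move=> h; elim: (index_enum _) => [|i s IH].
  by apply: has_diff_ext (has_diff_cst 0 x) => v; rewrite big_nil.
by apply: has_diff_ext (has_diffD (h i) IH) => v; rewrite big_cons.
Qed.

Lemma has_diff_comp f x df (G : R -> R) a : has_diff f x df ->
  is_derive (f x) 1 G a -> has_diff (fun y => G (f y)) x (fun v => a * df v).
Proof.
move=> [f1 f2] hG; have dG : differentiable G (f x) by apply/derivable1_diffP.
have dc := differentiable_comp f1 dG; split=> // v.
rewrite [LHS](deriveE v dc) diff_comp // /= diff1E // -deriveE // f2 derive1E.
by rewrite derive_val /= [LHS]mulrC.
Qed.

Lemma has_diff_mulmx m (M : 'M[R]_(n, m)) i x :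
  has_diff (fun y => (y *m M) 0 i) x (fun v => (v *m M) 0 i).
Proof.
have h := has_diff_sum (fun j => has_diffZ (M j i) (has_diff_coord j x)).
by apply: has_diff_ext h => v; rewrite mxE; apply: eq_bigr => j _; rewrite mulrC.
Qed.

Lemma has_diff_quadratic (B : 'M[R]_n) x : symmetric_mx B ->
  has_diff (fun y => dot (y *m B) y) x (fun v => 2 * dot (x *m B) v).
Proof.
move=> sB.
have h := has_diff_sum (fun i => has_diffM (has_diff_mulmx B i x) (has_diff_coord i x)).
apply: has_diff_ext h => // v; rewrite big_split /= -/(dot (x *m B) v).
under eq_bigr do rewrite mulrC.
rewrite -/(dot (v *m B) x) dot_mulmx sB dotC; ring.
Qed.

Lemma has_diff_dot (w : 'rV[R]_n) x : has_diff (dot w) x (dot w).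
Proof.
exact: (has_diff_sum (fun i => has_diffZ (w 0 i) (has_diff_coord i x))).
Qed.

Lemma C2_data_quadratic A b c : symmetric_mx A ->
  C2_data setT (Q A b c) (fun x => x *m A + b) (fun=> A).
Proof.
move=> sA x _.
have [q1 q2] : has_diff (Q A b c) x (fun v => dot (x *m A + b) v).
  have h := has_diffD (has_diffD (has_diffZ 2^-1 (has_diff_quadratic x sA))
    (has_diff_dot b x)) (has_diff_cst c x).
  apply: has_diff_ext h => // v.
  by rewrite addr0 mulrA mulVf ?mul1r ?dotDl // pnatr_eq0.
have l i : has_diff (fun x => (x *m A + b) 0 i) x (fun v => (v *m A) 0 i).
  apply: has_diff_ext (has_diffD (has_diff_mulmx A i x) (has_diff_cst (b 0 i) x)) => v.
    by rewrite [RHS]mxE.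
  by rewrite addr0.
split=> //; [by move=> i; case: (l i) | by move=> i v; case: (l i) | ].
by move=> i j; apply: cst_continuous.
Qed.

Lemma C2_data_add (U : set 'rV[R]_n) f1 f2 (g1 g2 : 'rV[R]_n -> 'rV[R]_n) H1 H2 : C2_data U f1 g1 H1 -> C2_data U f2 g2 H2 ->
  C2_data U (fun x => f1 x + f2 x) (fun x => g1 x + g2 x) (fun x => H1 x + H2 x).
Proof.
move=> h1 h2 x Ux; have [a1 a2 a3 a4 a5] := h1 x Ux; have [b1 b2 b3 b4 b5] := h2 x Ux.
have [q1 q2] := has_diffD (conj a1 a2) (conj b1 b2).
have l i : has_diff (fun x => (g1 x + g2 x) 0 i) x (fun v => (v *m (H1 x + H2 x)) 0 i).
  apply: has_diff_ext (has_diffD (conj (a3 i) (a4 i)) (conj (b3 i) (b4 i))) => v.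
    by rewrite [RHS]mxE.
  by rewrite mulmxDr [RHS]mxE.
split=> //; [by move=> v; rewrite q2 dotDl | by move=> i; case: (l i) | by move=> i v; case: (l i) | ].
move=> i j; have := continuousD (a5 i j) (b5 i j).
by apply: near_eq_continuous; near=> y; rewrite [RHS]mxE.
Unshelve. all: by end_near. Qed.

(** Hessian of a function of the quadratic form of B: here (xB)^T (xB) is the rank
one matrix coming from the gradient of the form. *)
Lemma C2_data_radial (B : 'M[R]_n) (G G1 G2 : R -> R) : symmetric_mx B ->
  (forall s : R, 0 < s -> is_derive s 1 G (G1 s)) ->
  (forall s : R, 0 < s -> is_derive s 1 G1 (G2 s)) ->
  (forall s : R, 0 < s -> {for s, continuous G2}) ->
  let s x := dot (x *m B) x in
  C2_data [set x | 0 < s x] (fun x => G (s x)) (fun x => (2 * G1 (s x)) *: (x *m B))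
    (fun x => (2 * G1 (s x)) *: B + (4 * G2 (s x)) *: ((x *m B)^T *m (x *m B))).
Proof.
move=> sB dG dG1 cG2 s x /= sx.
have hs := has_diff_quadratic x sB.
have [q1 q2] := has_diff_comp hs (dG _ sx).
have h1 := has_diff_comp hs (dG1 _ sx).
have l i : has_diff (fun x => ((2 * G1 (s x)) *: (x *m B)) 0 i) x
  (fun v => (v *m ((2 * G1 (s x)) *: B + (4 * G2 (s x)) *: ((x *m B)^T *m (x *m B)))) 0 i).
  apply: has_diff_ext (has_diffM (has_diffZ 2 h1) (has_diff_mulmx B i x)) => v.
    by rewrite [RHS]mxE.
  rewrite -/(s x); move: (x *m B) => w.
  rewrite mulmxDr -!scalemxAr mulmxA dotE mul_scalar_mx dotC.
  move: (v *m B) (dot w v) => z d; rewrite !mxE; ring.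
split=> //; [ | by move=> i; case: (l i) | by move=> i v; case: (l i) | ].
  by move=> v; rewrite q2 dotZl -/(s x); ring.
move=> i j.
have cs : {for x, continuous s} by apply: differentiable_continuous; case: hs.
have c1 : {for x, continuous (fun y => G1 (s y))}.
  by apply: differentiable_continuous; case: h1.
have c2 : {for x, continuous (fun y => G2 (s y))}.
  by apply: (continuous_comp cs); apply: cG2.
have cB k : {for x, continuous (fun y : 'rV[R]_n => (y *m B) 0 k : R)}.
  by apply: differentiable_continuous; case: (has_diff_mulmx B k x).
have cc c : {for x, continuous (fun _ : 'rV[R]_n => c : R)}.
  by apply: cst_continuous.
have := continuousD (continuousM (continuousM (cc 2) c1) (cc (B i j)))
  (continuousM (continuousM (cc 4) c2) (continuousM (cB i) (cB j))).
apply: near_eq_continuous; near=> y.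
rewrite !fctE /=; move: (y *m B) => w; rewrite !mxE big_ord1 !mxE.
Unshelve. all: by end_near. Qed.
End Directional.

(** * Symmetry of second derivatives and the second order condition *)

Section SecondOrder.
Variables (R : realType) (n : nat).
Implicit Types (f : 'rV[R]_n -> R) (x v w : 'rV[R]_n) (U : set 'rV[R]_n).

Lemma is_derive_line f x v (t : R) : differentiable f (x + t *: v) ->
  is_derive t 1 (fun s : R => f (x + s *: v)) ('D_v f (x + t *: v)).
Proof.
move=> df; have dv := @diff_derivable _ _ _ f _ v df.
have E : (fun h : R => h^-1 *: (((fun s : R => f (x + s *: v)) \o shift t) (h *: 1) -
     f (x + t *: v))) =
  (fun h : R => h^-1 *: ((f \o shift (x + t *: v)) (h *: v) - f (x + t *: v))).
  apply/funext => h /=; congr (_ *: (f _ - _)).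
  by rewrite [h *: 1]mulr1 scalerDl addrCA.
by apply: DeriveDef; rewrite /derivable /derive E.
Qed.

Lemma mvt_line f x v (t : R) : 0 < t ->
  (forall s, 0 <= s <= t -> differentiable f (x + s *: v)) ->
  exists2 s, 0 < s < t & f (x + t *: v) - f x = t * 'D_v f (x + s *: v).
Proof.
move=> t0 df.
have D s : s \in `]0, t[%R -> is_derive s 1 (fun s : R => f (x + s *: v)) ('D_v f (x + s *: v)).
  by rewrite in_itv /= => /andP[s0 st]; apply: is_derive_line; apply: df; rewrite !ltW.
have C : {within `[0, t], continuous (fun s : R => f (x + s *: v))}.
  apply: derivable_within_continuous => s; rewrite in_itv /= => s0t.
  by have [] := is_derive_line (df _ s0t).
have [s] := MVT t0 D C; rewrite in_itv /= => s0t.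
by rewrite scale0r addr0 subr0 => ->; exists s => //; rewrite mulrC.
Qed.

Lemma nbhs_box x v w (P : set 'rV[R]_n) : nbhs x P -> exists2 t : R, 0 < t &
  forall a b, 0 <= a <= t -> 0 <= b <= t -> P (x + a *: v + b *: w).
Proof.
move=> /nbhs_normP [r /= r0 rP].
have k0 : 0 < `|v| + `|w| + 1 by rewrite ltr_wpDl ?addr_ge0.
exists (r / 2 / (`|v| + `|w| + 1)); first by rewrite !divr_gt0.
set t := r / 2 / _ => a b /andP[a0 at_] /andP[b0 bt]; apply: rP => /=.
rewrite -addrA opprD addrA subrr add0r normrN.
apply: le_lt_trans (ler_normD _ _) _; rewrite !normrZ (ger0_norm a0) (ger0_norm b0).
have tk : t * (`|v| + `|w| + 1) = r / 2 by rewrite /t divfK // gt_eqF.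
have h1 := ler_wpM2r (normr_ge0 v) at_; have h2 := ler_wpM2r (normr_ge0 w) bt.
have t0 : 0 <= t by rewrite /t !divr_ge0 // ltW.
have : t * `|v| + t * `|w| <= r / 2 by rewrite -tk !mulrDr mulr1 lerDl.
lra.
Qed.

(** Two successive applications of the mean value theorem: first to the increment of
f along the j-th axis, in direction i, then to the i-th component of the gradient. *)
Lemma second_difference U f g H x i j (t : R) : C2_data U f g H -> 0 < t ->
  (forall a b, 0 <= a <= t -> 0 <= b <= t ->
     U (x + a *: delta_mx 0 i + b *: delta_mx 0 j)) ->
  exists a b, [/\ 0 <= a <= t, 0 <= b <= t &
    f (x + t *: delta_mx 0 i + t *: delta_mx 0 j) - f (x + t *: delta_mx 0 i)
      - f (x + t *: delta_mx 0 j) + f x =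
    t ^+ 2 * H (x + a *: delta_mx 0 i + b *: delta_mx 0 j) j i].
Proof.
move=> h t0 Ux; set v : 'rV[R]_n := delta_mx 0 i; set w : 'rV[R]_n := delta_mx 0 j.
have tt : 0 <= t <= t by rewrite lexx ltW.
have oo : (0 : R) <= 0 <= t by rewrite lexx ltW.
(* The second difference is the increment of F from x to x + t v. *)
pose F y := f (y + t *: w) - f y.
have sh y : differentiable f (y + t *: w) ->
    differentiable (fun y => f (y + t *: w)) y /\
    forall z, 'D_z (fun y => f (y + t *: w)) y = 'D_z f (y + t *: w).
  move=> df.
  have E z : (fun h : R => h^-1 *: (((fun y => f (y + t *: w)) \o shift y) (h *: z) - f (y + t *: w)))
     = (fun h : R => h^-1 *: ((f \o shift (y + t *: w)) (h *: z) - f (y + t *: w))).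
    by apply/funext => k /=; rewrite addrA.
  split=> [|z]; last by rewrite /derive E.
  have d1 : differentiable (fun y : 'rV[R]_n => y + t *: w) y.
    exact: differentiableD.
  exact: (differentiable_comp d1 df).
have dF s : 0 <= s <= t -> has_diff F (x + s *: v) (fun z =>
    dot (g (x + s *: v + t *: w)) z - dot (g (x + s *: v)) z).
  move=> st; have [f1 D1 _ _ _] := h _ (Ux s t st tt).
  have [f2 D2 _ _ _] := h _ (Ux s 0 st oo).
  rewrite scale0r addr0 in f2 D2.
  have [f3 D3] := sh _ f1.
  have D13 z : 'D_z (fun y => f (y + t *: w)) (x + s *: v) = dot (g (x + s *: v + t *: w)) z.
    by rewrite D3 D1.
  have := has_diffD (conj f3 D13) (has_diffZ (-1) (conj f2 D2)).
  by apply: has_diff_ext => z; rewrite mulN1r.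
have [a /andP[a0 at_] Ea] := mvt_line t0 (fun s st => (dF s st).1).
have {}at_ : 0 <= a <= t by rewrite !ltW.
have [b /andP[b0 bt] Eb] : exists2 b, 0 < b < t &
    g (x + a *: v + t *: w) 0 i - g (x + a *: v) 0 i =
    t * 'D_w (fun y => g y 0 i : R) (x + a *: v + b *: w).
  apply: (@mvt_line (fun y => g y 0 i)) => // s st.
  by have [_ _ + _ _] := h _ (Ux a s at_ st); apply.
have {}bt : 0 <= b <= t by rewrite !ltW.
exists a, b; split=> //.
have [_ _ _ DH _] := h _ (Ux a b at_ bt).
rewrite DH -rowE mxE in Eb.
rewrite (dF a at_).2 !dot_delta Eb mulrA -expr2 in Ea.
by rewrite -Ea /F; ring.
Qed.

(** The second difference is symmetric in i and j, and the points where the mean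
value theorem evaluates the second derivatives tend to x. *)
Lemma C2_data_symmetric U f g H x : open U -> C2_data U f g H -> U x ->
  symmetric_mx (H x).
Proof.
move=> oU h Ux; apply/matrixP => i j; rewrite mxE.
apply/eqP; rewrite -subr_eq0 -normr_le0; apply/ler_addgt0Pl => e e0.
rewrite addr0; have e2 : 0 < e / 2 by rewrite divr_gt0.
have [_ _ _ _ c] := h _ Ux.
pose P y := [/\ U y, `|H x j i - H y j i| < e / 2 & `|H x i j - H y i j| < e / 2].
have nP : nbhs x P.
  have /cvgrPdist_lt/(_ _ e2) n1 := c j i; have /cvgrPdist_lt/(_ _ e2) n2 := c i j.
  have n3 := open_nbhs_nbhs (conj oU Ux).
  near=> y; split; [near: y; exact: n3 | near: y; exact: n1 | near: y; exact: n2].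
have [t1 t10 b1] := nbhs_box (delta_mx 0 i) (delta_mx 0 j) nP.
have [t2 t20 b2] := nbhs_box (delta_mx 0 j) (delta_mx 0 i) nP.
pose t := Num.min t1 t2; have t0 : 0 < t by rewrite lt_min t10.
have le1 a : 0 <= a <= t -> 0 <= a <= t1 by rewrite le_min => /and3P[-> ->].
have le2 a : 0 <= a <= t -> 0 <= a <= t2 by rewrite le_min => /and3P[-> _ ->].
have [|a [b [at_ bt E1]]] := @second_difference U f g H x i j t h t0.
  by move=> a b /le1 ha /le1 hb; have [] := b1 _ _ ha hb.
have [|a' [b' [at' bt' E2]]] := @second_difference U f g H x j i t h t0.
  by move=> a' b' /le2 ha /le2 hb; have [] := b2 _ _ ha hb.
have [_ h1 _] := b1 _ _ (le1 _ at_) (le1 _ bt).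
have [_ _ h2] := b2 _ _ (le2 _ at') (le2 _ bt').
have E : H (x + a *: delta_mx 0 i + b *: delta_mx 0 j) j i =
   H (x + a' *: delta_mx 0 j + b' *: delta_mx 0 i) i j.
  have t2n : t ^+ 2 != 0 by rewrite expf_neq0 // gt_eqF.
  rewrite [x + t *: _ + t *: _]addrAC in E2.
  by apply: (mulfI t2n); rewrite -E1 -E2; ring.
rewrite E in h1; rewrite (splitr e) distrC.
have -> : H x i j - H x j i = (H x i j - H (x + a' *: delta_mx 0 j + b' *: delta_mx 0 i) i j)
  - (H x j i - H (x + a' *: delta_mx 0 j + b' *: delta_mx 0 i) i j) by ring.
by apply: le_trans (ler_normB _ _) _; rewrite ltW // ltrD.
Unshelve. all: by end_near. Qed.

(** If q > 0, then p1 > 0 just to the right of the critical point 0, and p would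
increase there. *)
Lemma second_derivative_max (p p1 : R -> R) (q d : R) : 0 < d ->
  (forall t : R, `|t| < d -> is_derive t 1 p (p1 t)) ->
  (forall t : R, `|t| < d -> p t <= p 0) -> is_derive (0 : R) 1 p1 q -> q <= 0.
Proof.
move=> d0 dp mp dq; rewrite leNgt; apply/negP => q0.
have p10 : p1 0 = 0.
  have : is_derive (0 : R) 1 p 0.
    apply: (@derive1_at_max _ p (- d) d).
    - by rewrite lerNl (le_trans _ (ltW d0)) // oppr_le0 ltW.
    - by move=> t; rewrite in_itv /= -ltr_norml => /dp [].
    - by rewrite in_itv /= oppr_lt0 d0.
    - by move=> t; rewrite in_itv /= -ltr_norml => /mp.
  have h := dp 0; rewrite normr0 in h; have [_ <-] := h d0.
  by case.
have : \forall t \near 0^'+, 0 < p1 t.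
  have [c1 c2] := dq.
  have cv : (fun h : R => h^-1 *: ((p1 \o shift 0) (h *: 1) - p1 0)) @ 0^' --> q.
    by rewrite -c2; exact: c1.
  have /cvgrPdist_lt/(_ _ q0) := cv; rewrite near_withinE near_withinE => hn.
  near=> t => t0.
  have : t != 0 -> `|q - t^-1 *: ((p1 \o shift 0) (t *: 1) - p1 0)| < q.
    by near: t; exact: hn.
  rewrite gt_eqF // => /(_ isT); rewrite p10 subr0 /= addr0 [t *: 1]mulr1.
  rewrite ltr_norml => /andP[_]; rewrite ltrBlDr ltrDl pmulr_rgt0 // invr_gt0 //.
rewrite near_withinE => /nbhs_normP[r /= r0 rP].
pose s := Num.min (d / 2) (r / 2).
have s0 : 0 < s by rewrite lt_min !divr_gt0.
have sd : s < d by rewrite gt_min; apply/orP; left; rewrite ltr_pdivrMr // ltr_pMr // ltr1n.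
have sr : s < r by rewrite gt_min; apply/orP; right; rewrite ltr_pdivrMr // ltr_pMr // ltr1n.
have nd t : 0 <= t <= s -> `|t| < d.
  by move=> /andP[t0 ts]; rewrite ger0_norm // (le_lt_trans ts).
have D t : t \in `]0, s[%R -> is_derive t 1 p (p1 t).
  by rewrite in_itv /= => /andP[t0 ts]; apply: dp; apply: nd; rewrite !ltW.
have C : {within `[0, s], continuous p}.
  apply: derivable_within_continuous => t; rewrite in_itv /= => /nd h.
  by have [] := dp _ h.
have [t] := MVT s0 D C; rewrite in_itv /= subr0 => /andP[t0 ts] E.
have h1 : 0 < p1 t.
  apply: rP => //=; rewrite sub0r normrN gtr0_norm //; exact: lt_trans ts sr.
have h2 : p s <= p 0 by apply: mp; apply: nd; rewrite lexx ltW.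
have : 0 < p1 t * s by rewrite mulr_gt0.
by rewrite -E subr_gt0 ltNge h2.
Unshelve. all: by end_near. Qed.

Lemma hessian_at_max U f g H x : open U -> C2_data U f g H -> U x ->
  (\forall y \near x, f y <= f x) -> forall v, dot (v *m H x) v <= 0.
Proof.
move=> oU h Ux fm v.
have nU := open_nbhs_nbhs (conj oU Ux).
have [t t0 bt] := nbhs_box v (- v) (filterI nU fm).
have inU s : `|s| < t -> U (x + s *: v) /\ f (x + s *: v) <= f x.
  rewrite ltr_norml => /andP[s1 s2]; have [s0|s0] := leP 0 s.
    by have := bt s 0; rewrite scale0r addr0; apply; rewrite ?lexx ?s0 /= ltW.
  have := bt 0 (- s); rewrite scale0r addr0 scalerN scaleNr opprK; apply.
    by rewrite lexx ltW.
  by rewrite oppr_ge0 ltW //= ltW // ltrNl.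
apply: (@second_derivative_max (fun s : R => f (x + s *: v))
  (fun s : R => dot (g (x + s *: v)) v) _ t t0).
- move=> s /inU [Us _]; have [df D _ _ _] := h _ Us.
  by rewrite -D; apply: is_derive_line.
- by move=> s /inU [_]; rewrite scale0r addr0.
have hd : has_diff (fun y => dot (g y) v) x (fun w => dot (w *m H x) v).
  have [_ _ d1 D1 _] := h _ Ux.
  have := has_diff_sum (fun i => has_diffZ (v 0 i) (conj (d1 i) (D1 i))).
  by apply: has_diff_ext => y; apply: eq_bigr => i _; rewrite mulrC.
have [d1 D1] := hd.
have := @is_derive_line (fun y => dot (g y) v) x v 0.
rewrite scale0r addr0 D1 => /(_ d1) hl; exact: hl.
Qed.
End SecondOrder.

(** * Comparison principles *)

Section Viscosity.
Variables (R : realType) (n : nat).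
Implicit Types (f u w : 'rV[R]_n -> R) (x v : 'rV[R]_n) (U V Om : set 'rV[R]_n).

Lemma derive_grad f x v : differentiable f x -> 'D_v f x = dot (grad f x) v.
Proof.
move=> df; rewrite (deriveE v df) {1}(row_sum_delta v) linear_sum.
apply: eq_bigr => i _; rewrite linearZ /= mxE /partial /= (deriveE _ df).
by rewrite mulrC.
Qed.

(** The continuity of second derivatives in [C2_data] is that of the iterated partial
derivatives, and differentiability expresses all directional derivatives by them. *)
Lemma class_C2_data U f : class_C 2 U f -> C2_data U f (grad f) (hessian f).
Proof.
move=> cf x Ux.
have gE i : (fun x => grad f x 0 i : R) = partial [:: i] f.
  by apply/funext => y; rewrite mxE.
have d0 := (cf [::] x Ux).2 isT; have d1 i := (cf [:: i] x Ux).2 isT.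
split=> [//|v|i|i v|i j].
- exact: derive_grad.
- by rewrite gE.
- rewrite gE derive_grad // /dot [RHS]mxE; apply: eq_bigr => j _.
  by rewrite !mxE mulrC.
have -> : (fun x => hessian f x i j : R) = partial [:: i; j] f.
  by apply/funext => y; rewrite mxE.
by have [/(_ isT)] := cf [:: i; j] x Ux.
Qed.

Lemma C2_data_opp U f (g : 'rV[R]_n -> 'rV[R]_n) H : C2_data U f g H ->
  C2_data U (fun x => - f x) (fun x => - g x) (fun x => - H x).
Proof.
move=> h x Ux; have [a1 a2 a3 a4 a5] := h x Ux.
have N p dp : has_diff p x dp -> has_diff (fun y => - p y) x (fun v => - dp v).
  move=> hp; have := has_diffZ (-1) hp.
  by apply: has_diff_ext => y; rewrite mulN1r.
have [q1 q2] := N _ _ (conj a1 a2).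
have l i : has_diff (fun x => (- g x) 0 i) x (fun v => (v *m (- H x)) 0 i).
  apply: has_diff_ext (N _ _ (conj (a3 i) (a4 i))) => v; first by rewrite [RHS]mxE.
  by rewrite mulmxN [RHS]mxE.
split=> [//|v|i|i v|i j]; [by rewrite q2 dotNl | by case: (l i) | by case: (l i) | ].
have := continuousN (a5 i j).
by apply: near_eq_continuous; near=> y; rewrite [RHS]mxE.
Unshelve. all: by end_near. Qed.

Lemma C2_data_subset U V f (g : 'rV[R]_n -> 'rV[R]_n) H : V `<=` U ->
  C2_data U f g H -> C2_data V f g H.
Proof. by move=> VU h x /VU /h. Qed.

Lemma hessian_le_at_max U f1 f2 g1 g2 H1 H2 x : open U ->
  C2_data U f1 g1 H1 -> C2_data U f2 g2 H2 -> U x ->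
  (\forall y \near x, f1 y - f2 y <= f1 x - f2 x) ->
  forall v, 0 <= dot (v *m (H2 x - H1 x)) v.
Proof.
move=> oU h1 h2 Ux fm v.
have := hessian_at_max oU (C2_data_add h1 (C2_data_opp h2)) Ux fm v.
by rewrite -oppr_ge0 -dotNl -mulmxN opprB.
Qed.

(** At a touching point the Hessians are ordered, and sigma_k is monotone. *)
Lemma classical_viscosity k Om u : open Om -> admissible k Om u ->
  (forall x, Om x -> sigma k (eigenvalues (hessian u x)) = 1) ->
  viscosity_subsolution k Om u /\ viscosity_supersolution k Om u.
Proof.
move=> oO [uC uG] u1.
split=> x p Ox [U [oU Ux pC]] pm.
  have oV := openI oO oU.
  have du := C2_data_subset (@subIsetl _ Om U) (class_C2_data uC).
  have dp := C2_data_subset (@subIsetr _ Om U) (class_C2_data pC).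
  have Vx : (Om `&` U) x by [].
  have [gp mp] := Gamma_psd (C2_data_symmetric oV du Vx) (C2_data_symmetric oV dp Vx)
    (hessian_le_at_max oV du dp Vx pm) (uG _ Ox).
  by split; [exact: gp | rewrite -(u1 x Ox) mp].
move=> gp; have oV := openI oO oU.
have du := C2_data_subset (@subIsetl _ Om U) (class_C2_data uC).
have dp := C2_data_subset (@subIsetr _ Om U) (class_C2_data pC).
have Vx : (Om `&` U) x by [].
have pm' : \forall y \near x, p y - u y <= p x - u x.
  by apply: filterS pm => y; lra.
have [_ mp] := Gamma_psd (C2_data_symmetric oV dp Vx) (C2_data_symmetric oV du Vx)
  (hessian_le_at_max oV dp du Vx pm') gp.
by rewrite -(u1 x Ox) mp.
Qed.

Lemma continuous_dot : continuous (fun x : 'rV[R]_n => dot x x).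
Proof.
move=> x; apply: differentiable_continuous.
have [+ _] := has_diff_quadratic x (tr_scalar_mx n (1 : R)).
by under eq_fun do rewrite mulmx1.
Qed.

Lemma compact_ball_closed (C : set 'rV[R]_n) (r : R) : closed C ->
  compact (C `&` [set x | dot x x <= r]).
Proof.
move=> cC; apply: bounded_closed_compact.
  exists (`|r| + 1); split; first exact: num_real.
  move=> M rM x [_ /= xr]; rewrite /Num.Def.normr /= mx_normrE.
  have M1 : 1 <= M by apply: le_trans (ltW rM); rewrite lerDr.
  apply: bigmax_le => [|[a i] _ /=]; first exact: le_trans M1.
  rewrite (ord1 a) -(@ler_pXn2r _ 2) ?nnegrE ?normr_ge0 //; last exact: le_trans M1.
  have h : x 0 i ^+ 2 <= dot x x.
    by rewrite expr2; apply: (@ler_sum_term _ _ (fun i => x 0 i * x 0 i)) => j; rewrite -expr2 sqr_ge0.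
  rewrite real_normK ?num_real // (le_trans h) // (le_trans xr) //.
  rewrite (le_trans (ler_norm r)) // (le_trans _ (_ : M <= _)) //.
    by apply: ltW; apply: lt_trans rM; rewrite ltrDl.
  by rewrite expr2 ler_peMr // (le_trans _ M1).
apply: closedI => //.
have cont : {in ~` (fun x : 'rV[R]_n => dot x x) @^-1` [set y : R | y <= r],
    continuous (fun x : 'rV[R]_n => dot x x)} by move=> x _; exact: continuous_dot.
exact: (preimage_closed cont (@closed_le _ r)).
Qed.

(** The term e |x|^2 is what makes the comparison strict later on.  It is chosen
small enough on a large ball not to move the minimum to the boundary. *)
Lemma interior_min V f (x1 : 'rV[R]_n) : open V ->
  {within closure V, continuous f} ->
  (forall x, closure V x -> ~ V x -> 0 <= f x) ->
  (forall e : R, 0 < e -> exists r : R, forall x, V x -> r <= dot x x -> - e <= f x) ->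
  V x1 -> f x1 < 0 ->
  exists (e : R) x0, [/\ 0 < e, V x0 &
    \forall x \near x0, f x0 - e * dot x0 x0 <= f x - e * dot x x].
Proof.
move=> oV cf fb fi Vx1 f1.
(* Beyond radius r^(1/2), f >= - m/4, and e |x|^2 <= m/4 within it, while f = - m at
   x1: the minimum is neither on the sphere nor on the boundary of V. *)
pose m := - f x1; have m0 : 0 < m by rewrite oppr_gt0.
have [r0 hr0] := fi (m / 4) ltac:(by rewrite divr_gt0).
pose r := Num.max r0 (dot x1 x1) + 1.
have rr0 : r0 <= r by rewrite ler_wpDr // le_max lexx.
have r1 : dot x1 x1 < r by rewrite ltr_pwDr // le_max lexx orbT.
have rp : 0 < r by apply: le_lt_trans r1; exact: dot_ge0.
pose e := m / 4 / r; have e0 : 0 < e by rewrite !divr_gt0.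
have er : e * r = m / 4 by rewrite /e divfK // gt_eqF.
have ed x : dot x x <= r -> e * dot x x <= m / 4.
  by move=> xr; rewrite -er ler_wpM2l // ltW.
pose K := closure V `&` [set x | dot x x <= r].
have cK : compact K by apply: compact_ball_closed; exact: closed_closure.
pose F x := f x - e * dot x x.
have cF : {within K, continuous F}.
  have cq : continuous (fun x : 'rV[R]_n => e * dot x x).
    move=> x; have ce : {for x, continuous (fun _ : 'rV[R]_n => e)} by apply: cst_continuous.
    exact: (continuousM ce (@continuous_dot x)).
  have cfK : {within K, continuous f} by apply: continuous_subspaceW cf => y [].
  move=> x; exact: (continuousB (cfK x) (continuous_subspaceT cq (x := x))).
have K1 : K x1 by split; [exact: subset_closure | exact: ltW].
have [x0 + x0min] := @EVT_min_rV _ _ F K (ex_intro _ x1 K1) cK cF.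
rewrite inE => -[Vx0 /= x0r].
have Fx0 : F x0 <= - m.
  apply: le_trans (x0min x1 _) _; first by rewrite inE.
  by rewrite /F /m opprK gerBl mulr_ge0 ?dot_ge0 // ltW.
have h := ed _ x0r; rewrite /F in Fx0.
have Vx0' : V x0 by apply: contrapT => /(fb _ Vx0); lra.
have x0r' : dot x0 x0 < r.
  rewrite lt_def x0r andbT; apply/eqP => rx0.
  have := hr0 x0 Vx0'; rewrite -rx0 => /(_ rr0); lra.
exists e, x0; split=> //.
have n1 := open_nbhs_nbhs (conj oV Vx0').
have n2 : \forall x \near x0, dot x x < r.
  exact: (@continuous_dot x0 _ (lt_nbhsl x0r')).
apply: filterS2 n1 n2 => x Vx xr; apply: x0min; rewrite inE.
by split; [exact: subset_closure | exact: ltW].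
Qed.

Lemma C2_near_data V w (g : 'rV[R]_n -> 'rV[R]_n) H x : open V -> C2_data V w g H -> V x ->
  C2_near x w.
Proof. by move=> oV h Vx; exists V; split=> //; exact: C2_data_class_C oV h. Qed.

Lemma C2_data_add_square V w (g : 'rV[R]_n -> 'rV[R]_n) H (e : R) : C2_data V w g H ->
  C2_data V (fun x => w x + e * dot x x) (fun x => g x + (x *m (2 * e)%:M + 0)) (fun x => H x + (2 * e)%:M).
Proof.
move=> h; have hq := C2_data_quadratic (0 : 'rV[R]_n) 0 (tr_scalar_mx n (2 * e)).
have := C2_data_add h (C2_data_subset (@subsetT _ V) hq).
congr C2_data; apply/funext => x; congr (_ + _).
rewrite /Q mul_mx_scalar dotZl mulrA mulrA mulVf ?pnatr_eq0 // mul1r addr0.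
by rewrite /dot [X in _ + X]big1 ?addr0 // => i _; rewrite mxE mul0r.
Qed.

(** Comparison with an admissible smooth subsolution w: if w exceeded u somewhere,
w + e |x|^2 would touch u from below, and its sigma_k is strictly above 1. *)
Lemma supersolution_ge k Om V u w (g : 'rV[R]_n -> 'rV[R]_n) H :
  viscosity_supersolution k.+1 Om u -> open V -> V `<=` Om -> C2_data V w g H ->
  (forall x, V x -> Gamma k.+1 (eigenvalues (H x)) /\ 1 <= sigma k.+1 (eigenvalues (H x))) ->
  {within closure V, continuous (fun x => u x - w x)} ->
  (forall x, closure V x -> ~ V x -> w x <= u x) ->
  (forall e : R, 0 < e -> exists r : R, forall x, V x -> r <= dot x x -> w x - e <= u x) ->
  forall x, V x -> w x <= u x.
Proof.
move=> su oV VO dw sw cf fb fi x Vx; rewrite leNgt; apply/negP => ux.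
have [||| e [x0 [e0 Vx0 nx0]]] := @interior_min V (fun x => u x - w x) x oV cf _ _ Vx.
- by move=> y cy ny; rewrite subr_ge0 fb.
- move=> e /fi [r hr]; exists r => y Vy ry; have := hr y Vy ry; lra.
- by rewrite subr_lt0.
have dp := C2_data_add_square e dw.
have sH := C2_data_symmetric oV dw Vx0.
have [g0 s0] := sw _ Vx0.
have [g1 s1] := sigma_add_scalar_lt sH g0 (mulr_gt0 (ltr0n _ 2) e0).
have nx : \forall y \near x0, u x0 - (w x0 + e * dot x0 x0) <= u y - (w y + e * dot y y).
  by apply: filterS nx0 => y; lra.
have := su x0 (fun x => w x + e * dot x x) (VO _ Vx0) (C2_near_data oV dp Vx0) nx.
by rewrite (C2_data_hessian oV dp Vx0) => /(_ g1); rewrite leNgt (le_lt_trans s0 s1).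
Qed.

(** Comparison with a smooth supersolution w: if u exceeded w somewhere,
w - e |x|^2 would touch u from above; being admissible there, its Hessian has sigma_k
strictly below that of w. *)
Lemma subsolution_le k Om V u w (g : 'rV[R]_n -> 'rV[R]_n) H :
  viscosity_subsolution k.+1 Om u -> open V -> V `<=` Om -> C2_data V w g H ->
  (forall x, V x -> sigma k.+1 (eigenvalues (H x)) <= 1) ->
  {within closure V, continuous (fun x => w x - u x)} ->
  (forall x, closure V x -> ~ V x -> u x <= w x) ->
  (forall e : R, 0 < e -> exists r : R, forall x, V x -> r <= dot x x -> u x - e <= w x) ->
  forall x, V x -> u x <= w x.
Proof.
move=> su oV VO dw sw cf fb fi x Vx; rewrite leNgt; apply/negP => ux.
have [||| e [x0 [e0 Vx0 nx0]]] := @interior_min V (fun x => w x - u x) x oV cf _ _ Vx.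
- by move=> y cy ny; rewrite subr_ge0 fb.
- move=> e /fi [r hr]; exists r => y Vy ry; have := hr y Vy ry; lra.
- by rewrite subr_lt0.
have dp := C2_data_add_square (- e) dw.
have sH := C2_data_symmetric oV dp Vx0.
have nx : \forall y \near x0, u y - (w y + - e * dot y y) <= u x0 - (w x0 + - e * dot x0 x0).
  by apply: filterS nx0 => y; lra.
have [g0 s0] := su x0 (fun x => w x + - e * dot x x) (VO _ Vx0) (C2_near_data oV dp Vx0) nx.
rewrite (C2_data_hessian oV dp Vx0) in g0 s0.
have [g1] := sigma_add_scalar_lt sH g0 (mulr_gt0 (ltr0n _ 2) e0).
have -> : H x0 + (2 * - e)%:M + (2 * e)%:M = H x0.
  by rewrite -addrA -raddfD /= mulrN addNr raddf0 addr0.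
by rewrite ltNge (le_trans (sw _ Vx0) s0).
Qed.
End Viscosity.

(** * Powers of rho = s^(-1/2) *)

Section RadialBarrier.
Variable R : realType.

(** For s = x B x^T this is the reciprocal of the norm of x defined by B, so that the
n - 2 power of rho is the fundamental solution.  All exponents are then integers. *)
Definition rho (s : R) : R := (Num.sqrt s)^-1.

Lemma rho_gt0 s : 0 < s -> 0 < rho s.
Proof. by move=> s0; rewrite invr_gt0 sqrtr_gt0. Qed.

Lemma rho_sqr s : 0 < s -> rho s ^+ 2 * s = 1.
Proof. by move=> s0; rewrite exprVn sqr_sqrtr ?ltW // mulVf // gt_eqF. Qed.

Lemma is_derive_rhoX j (s : R) : 0 < s ->
  is_derive s 1 (fun t => rho t ^+ j) (- (j%:R / 2) * rho s ^+ j.+2).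
Proof.
move=> s0; have r0 := rho_gt0 s0.
have h : is_derive s 1 rho (- 2^-1 * rho s ^+ 3).
  have ss0 : Num.sqrt s != 0 by rewrite gt_eqF // sqrtr_gt0.
  have d := is_derive1_sqrt s0.
  have [d1 d2] := d; apply: DeriveDef; first exact: derivableV.
  by rewrite deriveV // d2 /rho [LHS]mulrC; field.
have -> : (fun t => rho t ^+ j) = rho ^+ j by rewrite exprfctE.
apply: is_derive_eq (is_deriveX j h) _; rewrite [LHS]mulrC.
by case: j => [|j] /=; [rewrite !(mul0r, mulr0, oppr0) | rewrite !exprS; field].
Qed.

(** The two exponents are consecutive, and differentiating in s raises both by 2
([is_derive_radial_profile]), so this family is closed under differentiation. *)
Definition radial_profile (i : nat) (al be : R) (s : R) : R :=
  al * rho s ^+ i + be * rho s ^+ i.+1.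

Lemma is_derive_radial_profile i al be (s : R) : 0 < s ->
  is_derive s 1 (radial_profile i al be)
    (radial_profile i.+2 (- (i%:R / 2) * al) (- (i.+1%:R / 2) * be) s).
Proof.
move=> s0.
have h := is_deriveD (is_deriveZ al (is_derive_rhoX i s0)) (is_deriveZ be (is_derive_rhoX i.+1 s0)).
apply: is_derive_eq h _.
by rewrite /radial_profile /= /GRing.scale /=; ring.
Qed.

(** Here n = m + 3 and r = rho.  The quantities p and - qs are the coefficients, in the
Hessian of the barrier, of B and of s^(-1) (xB)^T (xB).  In n p - qs the leading terms
cancel, because rho^(n-2) is a fundamental solution, and there remains
N r^(n+1) (n-1) th, which dominates K p^2 when r t0 <= 1 and c is small with respect
to t0^2. *)
Lemma barrier_constants m (K d c t0 r : R) :
  0 < c -> 0 < t0 -> 0 < r -> r * t0 <= 1 -> 0 <= K ->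
  16 * K * m.+1%:R ^+ 2 * c <= m.+2%:R * t0 ^+ 2 ->
  4 * m.+1%:R * c <= d * t0 ^+ 2 ->
  let th := t0 / 4 in let N := 4 * c * t0 ^+ m.+1 in
  let p := N * r ^+ m.+3 * (m.+1%:R - m.+2%:R * (th * r)) in
  let qs := N * r ^+ m.+3 * (m.+1%:R * m.+3%:R - m.+2%:R * m.+4%:R * (th * r)) in
  [/\ 0 <= p <= d, 0 <= qs, qs <= (2 * m.+1%:R * m.+3%:R) * p &
      K * p ^+ 2 <= m.+3%:R * p - qs].
Proof.
move=> c0 t00 r0 rt K0 hK hd th N p qs.
pose z := th * r; have z0 : 0 < z by rewrite /z /th !mulr_gt0 // invr_gt0.
have z1 : z <= 4^-1 by rewrite /z /th mulrAC mulrC ler_piMr ?invr_ge0 // mulrC.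
have N0 : 0 < N by rewrite !mulr_gt0 // exprn_gt0.
(* e2 is bounded by 4 c / t0, and N r^n = e2 r by 4 c / t0^2. *)
pose e2 := N * r ^+ m.+2; have e20 : 0 < e2 by rewrite mulr_gt0 // exprn_gt0.
have e2t : e2 * t0 <= 4 * c.
  have -> : e2 * t0 = 4 * c * (r * t0) ^+ m.+2 by rewrite exprMn /e2 /N [t0 ^+ m.+2]exprS; ring.
  by apply: ler_piMr; [rewrite mulr_ge0 // ltW | apply: exprn_ile1; rewrite // ltW // mulr_gt0].
have eE : N * r ^+ m.+3 = e2 * r by rewrite /e2 exprSr mulrA.
rewrite /p /qs eE -/z; clear p qs; clearbody e2.
have et : e2 * r * t0 ^+ 2 <= 4 * c.
  have -> : e2 * r * t0 ^+ 2 = (r * t0) * (e2 * t0) by ring.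
  by apply: le_trans e2t; rewrite ler_piMl // ltW // mulr_gt0.
set e := e2 * r in et *.
have e0 : 0 < e by rewrite mulr_gt0.
have x0 : (0 : R) <= m%:R by rewrite ler0n.
have -> : m.+1%:R = m%:R + 1 :> R by rewrite -natr1.
have -> : m.+2%:R = m%:R + 2 :> R by rewrite -addn2 natrD.
have -> : m.+3%:R = m%:R + 3 :> R by rewrite -addn3 natrD.
have -> : m.+4%:R = m%:R + 4 :> R by rewrite -addn4 natrD.
have E1 : m.+1%:R = m%:R + 1 :> R by rewrite -natr1.
have E2 : m.+2%:R = m%:R + 2 :> R by rewrite -addn2 natrD.
rewrite E1 E2 in hK; rewrite E1 in hd.
move: (m%:R : R) x0 hK hd => x x0 hK hd.
have P1 : 2^-1 <= x + 1 - (x + 2) * z by nra.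
have P2 : x + 1 - (x + 2) * z <= x + 1 by nra.
have Q1 : 0 <= (x + 1) * (x + 3) - (x + 2) * (x + 4) * z by nra.
have Q2 : (x + 1) * (x + 3) - (x + 2) * (x + 4) * z <= (x + 1) * (x + 3) by nra.
have t2 : 0 < t0 ^+ 2 by rewrite exprn_gt0.
set P := x + 1 - _ in P1 P2 *; set T := _ * (x + 3) - _ in Q1 Q2 *.
have P0 : 0 <= P by apply: le_trans P1; rewrite invr_ge0.
split.
- rewrite mulr_ge0 ?(ltW e0) //= -(ler_pM2r t2).
  have et0 : 0 <= e * t0 ^+ 2 by rewrite ltW // mulr_gt0.
  by apply: le_trans hd; have := ler_pM et0 P0 et P2; lra.
- by rewrite mulr_ge0 // ltW.
- rewrite [leRHS]mulrCA ler_wpM2l ?(ltW e0) //; apply: le_trans Q2 _.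
  have xx : 0 <= (x + 1) * (x + 3) by rewrite mulr_ge0 ?addr_ge0.
  have := ler_wpM2l xx P1; lra.
have -> : (x + 3) * (e * P) - e * T = e * ((x + 2) * z) by rewrite /P /T; ring.
rewrite exprMn expr2 -mulrA mulrCA ler_wpM2l ?(ltW e0) // /e /z.
rewrite (_ : K * _ = (K * P ^+ 2 * e2) * r); last by ring.
rewrite (_ : _ * (th * r) = ((x + 2) * th) * r); last by ring.
rewrite ler_wpM2r ?(ltW r0) // -(ler_pM2r t00).
apply: le_trans (_ : K * (x + 1) ^+ 2 * (4 * c) <= _).
  rewrite -[leLHS]mulrA; apply: ler_pM; last exact: e2t.
  - by rewrite mulr_ge0 // sqr_ge0.
  - by rewrite ltW // mulr_gt0.
  - by rewrite ler_wpM2l // lerXn2r // nnegrE addr_ge0.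
by rewrite /th; move: hK; lra.
Qed.
End RadialBarrier.

(** * Boundary data and behaviour at infinity *)

Section ExteriorProblem.
Variables (R : realType) (m : nat).
Notation n := m.+3.
Implicit Types (A : 'M[R]_n) (b x : 'rV[R]_n) (u phi : 'rV[R]_n -> R) (D : set 'rV[R]_n).

Lemma enorm_ge0 x : 0 <= enorm x.
Proof. exact: sqrtr_ge0. Qed.

Lemma enorm_sqr x : enorm x ^+ 2 = dot x x.
Proof. by rewrite sqr_sqrtr // dot_ge0. Qed.

Lemma enorm_ge x (r : R) : 0 <= r -> (r <= enorm x) = (r ^+ 2 <= dot x x).
Proof. by move=> r0; rewrite -enorm_sqr ler_pXn2r // nnegrE enorm_ge0. Qed.

Lemma asymptotic_limit A b c u : asymptotic_to_Q A b c u ->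
  forall e : R, 0 < e ->
    exists r : R, forall x, r <= dot x x -> `|u x - Q A b c x| <= e.
Proof.
move=> [M [r0 hM]] e e0; pose r := 1 + `|r0| + `|M| / e.
have Me : 0 <= `|M| / e by rewrite divr_ge0 // ltW.
have r1 : 1 <= r by rewrite /r -addrA lerDl addr_ge0.
exists (r ^+ 2) => x; rewrite -enorm_ge ?(le_trans ler01) // => rx.
have y1 : 1 <= enorm x by apply: le_trans rx.
have y0 : 0 < enorm x by apply: lt_le_trans y1.
have r0y : r0 <= enorm x.
  apply: le_trans (ler_norm r0) (le_trans _ rx).
  by rewrite /r addrAC addrC lerDl addr_ge0.
apply: le_trans (hM x r0y) _; rewrite ler_pdivrMr ?exprn_gt0 //.
apply: le_trans (ler_norm M) _; rewrite mulrC -ler_pdivrMr //.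
apply: le_trans (_ : r <= _); first by rewrite /r lerDr addr_ge0.
apply: le_trans rx _; rewrite -[leLHS]expr1 -[(n - 2)%N]/(m.+1).
by rewrite ler_weXn2l.
Qed.

Lemma bounded_closure D : bounded_set D ->
  exists2 r : R, 0 <= r & forall x, closure D x -> dot x x <= r.
Proof.
move=> [M [_ hM]]; pose N := `|M| + 1.
have hN x : D x -> `|x| <= N.
  by apply: hM; rewrite /N ltr_pwDr // ler_norm.
have N0 : 0 <= N by rewrite addr_ge0.
exists (n%:R * N ^+ 2); first by rewrite mulr_ge0 // sqr_ge0.
suff : closure D `<=` [set x | dot x x <= n%:R * N ^+ 2] by move=> h x /h.
have cont : {in ~` (fun x : 'rV[R]_n => dot x x) @^-1` [set y : R | y <= n%:R * N ^+ 2],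
    continuous (fun x : 'rV[R]_n => dot x x)} by move=> x _; exact: continuous_dot.
rewrite [X in _ `<=` X](_ : _ = closure [set x | dot x x <= n%:R * N ^+ 2]); last first.
  by apply/closure_id; exact: (preimage_closed cont (@closed_le _ _)).
apply: closure_subset => x /hN xN /=.
rewrite /dot mulr_natl -[in leRHS](card_ord n) -sumr_const; apply: ler_sum => i _.
rewrite -expr2 -real_normK ?num_real // lerXn2r ?nnegrE //.
apply: le_trans xN; rewrite /Num.Def.normr /= mx_normrE.
exact: (le_bigmax _ (fun ij : 'I_1 * 'I_n => `|x ij.1 ij.2|) (0, i)).
Qed.

Lemma bdry_compact D : bounded_set D -> compact (bdry D).
Proof.
move=> bD; have [r _ hr] := bounded_closure bD.
have -> : bdry D = (closure D `\` interior D) `&` [set x | dot x x <= r].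
  by apply/seteqP; split=> [x [cx ix]|x []//]; split=> //; exact: hr.
apply: compact_ball_closed; rewrite setDE; apply: closedI; first exact: closed_closure.
by apply: open_closedC; exact: open_interior.
Qed.

Lemma continuous_Q A b c : symmetric_mx A -> continuous (Q A b c).
Proof.
move=> sA x; apply: differentiable_continuous.
by have [] := C2_data_quadratic b c sA (I : setT x).
Qed.

(** M is the constant of the comparisons with the exact solutions Q_c and Q_(-M). *)
Lemma boundary_bound A b D phi : symmetric_mx A -> bounded_set D ->
  {within bdry D, continuous phi} ->
  exists2 M : R, 0 <= M & forall x, bdry D x -> `|phi x - Q A b 0 x| <= M.
Proof.
move=> sA bD cphi; pose F x := phi x - Q A b 0 x.
have cF : {within bdry D, continuous F}.
  have cQ : {within bdry D, continuous (Q A b 0)}.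
    by apply: continuous_subspaceT; exact: continuous_Q.
  by move=> x; exact: (continuousB (cphi x) (cQ x)).
have [|E0] := pselect (bdry D !=set0); last first.
  by exists 0 => // x bx; exfalso; apply: E0; exists x.
move=> ne; have cb := bdry_compact bD.
have [x1 _ h1] := EVT_min_rV ne cb cF; have [x2 _ h2] := EVT_max_rV ne cb cF.
exists (`|F x1| + `|F x2|) => [|x bx]; first exact: addr_ge0.
have bx' : x \in bdry D by rewrite inE.
have := h1 x bx'; have := h2 x bx'; rewrite -/(F x) ler_norml.
have := ler_norm (F x2); have := ler_norm (- F x1); rewrite normrN.
have := normr_ge0 (F x1); have := normr_ge0 (F x2); lra.
Qed.

Lemma closure_exterior D x : closure (exterior D) x -> ~ exterior D x -> bdry D x.
Proof.
move=> ce ne; have cD : closure D x by apply: contrapT.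
split=> // ix; have [y [ey iy]] := ce _ (open_nbhs_nbhs (conj (@open_interior _ D) ix)).
by apply: ey; apply: subset_closure; apply: interior_subset.
Qed.

Lemma smooth_on_boundary_continuous D phi : smooth_on_boundary D phi ->
  {within bdry D, continuous phi}.
Proof.
move=> sp; apply/subspace_continuousP => x bx.
have [U [g [oU Ux sg pg]]] := sp x bx.
have cg : {for x, continuous g} by have [/(_ isT)] := sg 0%N [::] x Ux.
have cw : g y @[y --> within (bdry D) (nbhs x)] --> phi x.
  by rewrite (pg x Ux bx); apply: cvg_trans cg; apply: cvg_app; exact: cvg_within.
apply: cvg_trans cw; apply: near_eq_cvg; rewrite near_withinE.
have := open_nbhs_nbhs (conj oU Ux); apply: filterS => y Uy ybd.
exact: esym (pg y Uy ybd).
Qed.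

Lemma classical_viscosity_solution k A b D phi c u :
  classical_solution k A b D phi c u -> viscosity_solution k A b D phi c u.
Proof.
move=> [[_ cu _] [ua u1] ub ui]; split=> //.
apply: classical_viscosity => //.
by apply: closed_openC; exact: closed_closure.
Qed.
End ExteriorProblem.

(** * The two bounds *)

Section Bounds.
Variables (R : realType) (m : nat).
Notation n := m.+3.
Implicit Types (A : 'M[R]_n) (b x : 'rV[R]_n) (u phi : 'rV[R]_n -> R) (D : set 'rV[R]_n).

Lemma Q_shift A b (c d : R) x : Q A b c x = Q A b d x + (c - d).
Proof. by rewrite /Q; ring. Qed.

Lemma open_exterior D : open (exterior D).
Proof. by apply: closed_openC; exact: closed_closure. Qed.

Lemma continuous_exterior D u V A b (c : R) : symmetric_mx A -> V `<=` exterior D ->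
  {within closure (exterior D), continuous u} ->
  {within closure V, continuous (fun x => u x - Q A b c x)}.
Proof.
move=> sA VD cu; have cuV : {within closure V, continuous u}.
  by apply: continuous_subspaceW cu; apply: closure_subset.
have cQ : {within closure V, continuous (Q A b c)}.
  by apply: continuous_subspaceT; exact: continuous_Q.
by move=> x; exact: (continuousB (cuV x) (cQ x)).
Qed.

(** Comparison with the exact solution Q_c. *)
Lemma upper_bound k A b D phi (c M : R) u : calA k.+1 A ->
  (forall x, bdry D x -> `|phi x - Q A b 0 x| <= M) -> M <= c ->
  viscosity_solution k.+1 A b D phi c u ->
  forall x, exterior D x -> u x <= Q A b c x.
Proof.
move=> [sA gA sA1] hM Mc [cu [sub _] ub ui].
apply: (subsolution_le sub (open_exterior (D := D)) (@subset_refl _ _)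
  (C2_data_subset (@subsetT _ _) (C2_data_quadratic b c sA))).
- by move=> x _; rewrite sA1.
- have := @continuous_exterior D u _ A b c sA (@subset_refl _ (exterior D)) cu => cF.
  have -> : (fun x => Q A b c x - u x) = (fun x => - (u x - Q A b c x)).
    by apply/funext => y; rewrite opprB.
  by move=> x; exact: (continuousN (cF x)).
- move=> x cx nx; have bx := closure_exterior cx nx.
  rewrite (ub _ bx) (Q_shift _ _ c 0); have := hM x bx; rewrite ler_norml; lra.
move=> e e0; have [r hr] := asymptotic_limit ui e0; exists r => x _ /hr.
rewrite ler_norml; lra.
Qed.

(** Comparison with the exact solution Q_(-M), which lies below phi on the
boundary and, when - M <= c, below u at infinity. *)
Lemma crude_lower_bound k A b D phi (c M : R) u : calA k.+1 A ->
  (forall x, bdry D x -> `|phi x - Q A b 0 x| <= M) -> - M <= c ->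
  viscosity_solution k.+1 A b D phi c u ->
  forall x, exterior D x -> Q A b (- M) x <= u x.
Proof.
move=> [sA gA sA1] hM Mc [cu [_ sup] ub ui].
apply: (supersolution_ge sup (open_exterior (D := D)) (@subset_refl _ _)
  (C2_data_subset (@subsetT _ _) (C2_data_quadratic b (- M) sA))).
- by move=> x _; rewrite sA1; split; [exact: gA | exact: lexx].
- exact: (@continuous_exterior D u _ A b (- M) sA (@subset_refl _ (exterior D)) cu).
- move=> x cx nx; have bx := closure_exterior cx nx.
  rewrite (ub _ bx) (Q_shift _ _ (- M) 0); have := hM x bx; rewrite ler_norml; lra.
move=> e e0; have [r hr] := asymptotic_limit ui e0; exists r => x _ /hr.
rewrite ler_norml (Q_shift _ _ (- M) c); lra.
Qed.

Lemma continuous_radial_profile i (al be s : R) : 0 < s -> {for s, continuous (radial_profile i al be)}.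
Proof.
move=> s0; apply: differentiable_continuous; apply/derivable1_diffP.
by have [] := is_derive_radial_profile i al be s0.
Qed.

(** The function Q_c - N (rho^(n-2) - (t0/4) rho^(n-1)) is an admissible
subsolution outside the ellipsoid s = t0^2, with b0 and b1 bounding the
eigenvalues of B. *)
Lemma radial_barrier k A (b : 'rV[R]_n) : calA k.+1 A ->
  exists (B : 'M[R]_n) (b0 b1 K d : R),
  [/\ symmetric_mx B, 0 < b0, 0 <= K, 0 < d &
  (forall x, b0 * dot x x <= dot (x *m B) x <= b1 * dot x x) /\
  forall c t0 : R, 0 < c -> 0 < t0 ->
    16 * K * m.+1%:R ^+ 2 * c <= m.+2%:R * t0 ^+ 2 ->
    4 * m.+1%:R * c <= d * t0 ^+ 2 ->
    let N := 4 * c * t0 ^+ m.+1 in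
    exists g H, C2_data [set x | t0 ^+ 2 < dot (x *m B) x]
      (fun x => Q A b c x + radial_profile m.+1 (- N) (N * (t0 / 4)) (dot (x *m B) x)) g H /\
      forall x, t0 ^+ 2 < dot (x *m B) x ->
       Gamma k.+1 (eigenvalues (H x)) /\ 1 <= sigma k.+1 (eigenvalues (H x))].
Proof.
move=> cA; pose L : R := 2 * m.+1%:R * m.+3%:R.
have L0 : 0 <= L by rewrite /L !mulr_ge0.
have [B [b0 [b1 [K [d [sB b00 K0 d0 [hB key]]]]]]] := barrier_matrix (ltn0Sn _) cA L0.
exists B, b0, b1, K, d; split; [exact: sB | exact: b00 | exact: K0 | exact: d0 |].
split; first exact: hB.
move=> c t0 c0 t00 hK hd N.
have [sA _ _] := cA.
pose G1 := radial_profile m.+3 (- (m.+1%:R / 2) * - N) (- (m.+2%:R / 2) * (N * (t0 / 4))).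
pose G2 := radial_profile m.+4.+1 (- (m.+3%:R / 2) * (- (m.+1%:R / 2) * - N))
  (- (m.+4%:R / 2) * (- (m.+2%:R / 2) * (N * (t0 / 4)))).
have dr := @C2_data_radial R n B (radial_profile m.+1 (- N) (N * (t0 / 4))) G1 G2 sB
  (fun s s0 => is_derive_radial_profile m.+1 (- N) (N * (t0 / 4)) s0)
  (fun s s0 => is_derive_radial_profile m.+3 _ _ s0) (fun s s0 => @continuous_radial_profile m.+4.+1 _ _ s s0).
rewrite /= in dr.
have t2 : 0 < t0 ^+ 2 by rewrite exprn_gt0.
have sub : [set x | t0 ^+ 2 < dot (x *m B) x] `<=` [set x | 0 < dot (x *m B) x].
  by move=> x /=; apply: lt_trans.
have dd := C2_data_add (C2_data_subset (@subsetT _ _) (C2_data_quadratic b c sA))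
  (C2_data_subset sub dr).
do 2!eexists; split; first exact: dd.
move=> x xs /=; set s := dot (x *m B) x in xs *.
have s0 : 0 < s by apply: lt_trans xs.
have r0 := rho_gt0 s0.
have rs := rho_sqr s0.
have rt : rho s * t0 <= 1.
  rewrite -(@ler_pXn2r _ 2) ?nnegrE ?ler01 //; last by rewrite mulr_ge0 // ltW.
  by rewrite expr1n exprMn -rs ler_wpM2l ?sqr_ge0 // ltW.
have [] := barrier_constants c0 t00 r0 rt K0 hK hd.
rewrite /= -/N; set p := N * _ * _; set qs := N * _ * _ => hp hq hqs hKp.
pose q := qs * rho s ^+ 2.
have qsE : q * s = qs by rewrite /q -mulrA rs mulr1.
have q0 : 0 <= q by rewrite mulr_ge0 // sqr_ge0.
have := key p q x hp q0; rewrite /= -/s qsE => /(_ hqs hKp) h.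
have e4 : rho s ^+ m.+4 = rho s ^+ m.+3 * rho s by rewrite exprSr.
have e5 : rho s ^+ m.+4.+1 = rho s ^+ m.+3 * rho s ^+ 2 by rewrite -exprD addn2.
have e6 : rho s ^+ m.+4.+2 = rho s ^+ m.+3 * rho s ^+ 3 by rewrite -exprD addn3.
rewrite (_ : A + _ = A + p *: B - q *: ((x *m B)^T *m (x *m B))); first exact: h.
rewrite addrA -scaleNr; congr (_ + _ *: _ + _ *: _).
  by rewrite /G1 /radial_profile /p e4; field.
by rewrite /G2 /radial_profile /q /qs e5 e6; field.
Qed.

(** The radial barrier is compared with u outside an ellipsoid of size comparable
to c, on which it lies below the crude lower bound. *)
Lemma exterior_estimate k A b D phi (M : R) : calA k.+1 A -> bounded_set D ->
  0 <= M -> (forall x, bdry D x -> `|phi x - Q A b 0 x| <= M) ->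
  exists c0 : R, forall c, c0 < c -> forall u,
    viscosity_solution k.+1 A b D phi c u -> forall x, c <= enorm x ->
    Q A b c x - 4 * c ^+ m.+2 * enorm x ^- m.+1 <= u x <= Q A b c x.
Proof.
move=> cA bD M0 hM; have [sA _ _] := cA.
have [B [b0 [b1 [K [d [sB b00 K0 d0 [hB key]]]]]]] := radial_barrier b cA.
have [r r_ge0 hr] := bounded_closure bD.
(* c1, c2 and c3 ensure the two conditions of the barrier and that the ellipsoid
   s = t0^2 encloses D. *)
pose c1 := 64 * K * m.+1%:R ^+ 2 / b0; pose c2 := 16 * m.+1%:R / (d * b0).
pose c3 := 4 * (`|b1| * r) / b0.
have c10 : 0 <= c1 by rewrite /c1 !mulr_ge0 ?invr_ge0 ?sqr_ge0 // ltW.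
have c20 : 0 <= c2 by rewrite /c2 !mulr_ge0 ?invr_ge0 ?mulr_ge0 // ltW.
have c30 : 0 <= c3 by rewrite /c3 !mulr_ge0 ?invr_ge0 // ltW.
exists (1 + M + c1 + c2 + c3) => c hc u uv.
have cgt1 : 1 < c by lra.
have Mc : M <= c by lra.
have c1c : c1 <= c by lra.
have c2c : c2 <= c by lra.
have c3c : c3 < c by lra.
have c0 : 0 < c by lra.
(* The factor 1 / 2 puts every x with |x| >= c outside the ellipsoid s = t0^2. *)
pose t0 := Num.sqrt b0 * c / 2.
have sb0 : 0 < Num.sqrt b0 by rewrite sqrtr_gt0.
have t00 : 0 < t0 by rewrite !mulr_gt0 // invr_gt0.
have t0E : t0 ^+ 2 = b0 * c ^+ 2 / 4.
  by rewrite /t0 !exprMn sqr_sqrtr ?ltW // exprVn; congr (_ / _); ring.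
have hK : 16 * K * m.+1%:R ^+ 2 * c <= m.+2%:R * t0 ^+ 2.
  have h : 64 * K * m.+1%:R ^+ 2 <= c * b0 by rewrite -ler_pdivrMr.
  have h2 := ler_wpM2r (ltW c0) h.
  apply: (@le_trans _ _ (t0 ^+ 2)); first by rewrite t0E; lra.
  by rewrite ler_peMl ?sqr_ge0 // ler1n.
have hd : 4 * m.+1%:R * c <= d * t0 ^+ 2.
  have h : 16 * m.+1%:R <= c * (d * b0) by rewrite -ler_pdivrMr // mulr_gt0.
  by have h2 := ler_wpM2r (ltW c0) h; rewrite t0E; lra.
have h3 : `|b1| * r < t0 ^+ 2.
  have h : 4 * (`|b1| * r) < c * b0 by rewrite -ltr_pdivrMr.
  have h2 : c * b0 <= c ^+ 2 * b0 by rewrite ler_wpM2r ?(ltW b00) // expr2 ler_peMr // ltW.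
  by rewrite t0E; lra.
have upper := upper_bound cA hM Mc uv.
have Mc' : - M <= c by lra.
have lower := crude_lower_bound cA hM Mc' uv.
have out x : t0 ^+ 2 <= dot (x *m B) x -> exterior D x.
  move=> xs /hr xr; have /andP[_ h] := hB x.
  have h4 : b1 * dot x x <= `|b1| * r.
    apply: le_trans (_ : `|b1| * dot x x <= _); last by rewrite ler_wpM2l.
    by rewrite ler_wpM2r ?dot_ge0 // ler_norm.
  lra.
pose V := [set x | t0 ^+ 2 < dot (x *m B) x].
pose s x := dot (x *m B) x.
have cs : continuous s.
  by move=> x; apply: differentiable_continuous; case: (has_diff_quadratic x sB).
have oV : open V.
  have cont : {in s @^-1` [set y : R | t0 ^+ 2 < y], continuous s} by move=> x _; exact: cs.
  exact: (open_comp cont (@open_gt _ (t0 ^+ 2))).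
have clV : closure V `<=` [set x | t0 ^+ 2 <= s x].
  have cont : {in ~` s @^-1` [set y : R | t0 ^+ 2 <= y], continuous s} by move=> x _; exact: cs.
  rewrite [X in _ `<=` X](closure_id _).1; last exact: (preimage_closed cont (@closed_ge _ (t0 ^+ 2))).
  by apply: closure_subset => x /ltW.
have [g [H [dw sw]]] := key c t0 c0 t00 hK hd.
set N := 4 * c * t0 ^+ m.+1 in dw sw.
have N0 : 0 < N by rewrite !mulr_gt0 // exprn_gt0.
have t02 : 0 < t0 ^+ 2 by rewrite exprn_gt0.
pose G y := radial_profile m.+1 (- N) (N * (t0 / 4)) y.
have GE y : G y = - (N * rho y ^+ m.+1 * (1 - t0 * rho y / 4)).
  by rewrite /G /radial_profile [rho y ^+ m.+2]exprSr; field.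
have rt y : t0 ^+ 2 <= y -> 0 < rho y /\ t0 * rho y <= 1.
  move=> ty; have y0 : 0 < y by apply: lt_le_trans ty.
  have ry := rho_gt0 y0; split=> //.
  rewrite -(@ler_pXn2r _ 2) ?nnegrE ?ler01 //; last by rewrite mulr_ge0 // ltW.
  by rewrite expr1n exprMn -(rho_sqr y0) mulrC ler_wpM2l ?sqr_ge0.
have Gle y : t0 ^+ 2 <= y -> G y <= 0.
  move=> /rt[ry rt1]; rewrite GE oppr_le0 mulr_ge0 //; last by lra.
  by rewrite mulr_ge0 ?(ltW N0) // exprn_ge0 // ltW.
have Gge y : t0 ^+ 2 <= y -> - (N * rho y ^+ m.+1) <= G y.
  move=> /rt[ry rt1]; rewrite GE lerN2 ler_piMr //.
    by rewrite mulr_ge0 ?(ltW N0) // exprn_ge0 // ltW.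
  by have : 0 < t0 * rho y by [rewrite mulr_gt0]; lra.
(* N is chosen for this value, which lies below the crude bound - (c + M). *)
have Gt0 : G (t0 ^+ 2) = - (3 * c).
  have rE : rho (t0 ^+ 2) = t0^-1 by rewrite /rho sqrtr_sqr gtr0_norm.
  rewrite GE rE divff ?gt_eqF // /N exprVn -(mulrA _ (t0 ^+ _)) divff ?gt_eqF ?exprn_gt0 //.
  by field.
have [cu [_ sup] ub ui] := uv.
have VO : V `<=` exterior D by move=> x /ltW /out.
have barrier : forall x, V x -> Q A b c x + G (s x) <= u x.
  apply: (supersolution_ge sup oV VO dw sw).
  - have cuV : {within closure V, continuous u}.
      apply: continuous_subspaceW cu => x /clV xs.
      by apply: subset_closure; exact: out.
    have cwV : {within closure V, continuous (fun x => Q A b c x + G (s x))}.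
      apply: continuous_in_subspaceT => x; rewrite inE => /clV xs.
      have sx : 0 < s x by apply: lt_le_trans xs.
      have cG : {for x, continuous (fun x => G (s x))}.
        exact: (continuous_comp (cs x) (continuous_radial_profile sx)).
      have cQ : {for x, continuous (Q A b c)} by apply: continuous_Q.
      exact: (continuousD cQ cG).
    by move=> x; exact: (continuousB (cuV x) (cwV x)).
  - move=> x /clV xs nx.
    have sE : dot (x *m B) x = t0 ^+ 2.
      by apply/eqP; rewrite eq_le xs andbT leNgt; apply/negP.
    have := lower x (out _ xs); rewrite (Q_shift _ _ (- M) c).
    by rewrite sE -/(G _) Gt0; lra.
  - move=> e e0; have [r1 hr1] := asymptotic_limit ui e0; exists r1 => x Vx /hr1.
    have := Gle _ (ltW Vx); rewrite -/(G _) ler_norml; lra.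
move=> x cx; have x0 : 0 < enorm x by apply: lt_le_trans cx.
have b0x : b0 * enorm x ^+ 2 <= s x by rewrite enorm_sqr; case/andP: (hB x).
have Vx : V x.
  apply: lt_le_trans b0x; rewrite t0E.
  have : c ^+ 2 <= enorm x ^+ 2 by rewrite lerXn2r ?nnegrE // ltW.
  have c2p : 0 < c ^+ 2 by rewrite exprn_gt0.
  move=> /(ler_wpM2l (ltW b00)); have : 0 < b0 * c ^+ 2 by rewrite mulr_gt0.
  lra.
rewrite (upper _ (VO _ Vx)) andbT.
apply: le_trans (barrier x Vx); rewrite lerD2l.
apply: le_trans (Gge _ (ltW Vx)); rewrite lerN2.
have s0 : 0 < s x by apply: lt_trans Vx.
have rx : rho (s x) <= (Num.sqrt b0 * enorm x)^-1.
  rewrite /rho lef_pV2 ?posrE ?sqrtr_gt0 ?mulr_gt0 //.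
  rewrite -[leLHS]gtr0_norm ?mulr_gt0 // -sqrtr_sqr; apply: ler_wsqrtr.
  by rewrite exprMn sqr_sqrtr // ltW.
apply: (@le_trans _ _ (N * (Num.sqrt b0 * enorm x)^-1 ^+ m.+1)).
  rewrite ler_wpM2l ?(ltW N0) //; apply: lerXn2r rx; rewrite nnegrE ltW //.
    exact: rho_gt0.
  by rewrite invr_gt0 mulr_gt0.
rewrite exprVn exprMn invfM /N /t0 !exprMn exprVn.
set y := Num.sqrt b0 ^+ m.+1; have y0 : y != 0 by rewrite expf_neq0 // gt_eqF.
rewrite -exprVn mulrA ler_wpM2r ?invr_ge0 ?exprn_ge0 ?(ltW x0) //.
have -> : 4 * c * (y * c ^+ m.+1 * 2^-1 ^+ m.+1) / y = (4 * c ^+ m.+2) * 2^-1 ^+ m.+1.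
  by move: (2^-1 ^+ m.+1) => h; rewrite [c ^+ m.+2]exprS; field.
apply: ler_piMr; first by rewrite mulr_ge0 // exprn_ge0 // ltW.
by apply: exprn_ile1; [rewrite invr_ge0 | rewrite invf_le1 // ler1n].
Qed.
End Bounds.

Theorem mainTheorem4 (R : realType) (n k : nat) (A : 'M[R]_n) (b : 'rV[R]_n)
    (D : set 'rV[R]_n) (phi : 'rV[R]_n -> R)
    (hn : (3 <= n)%N) (hk : (2 <= k <= n - 1)%N)
    (hA : calA k A) (hD : bounded_domain D) :
  (C11_domain D -> uniformly_convex D ->
   {within bdry D, continuous phi} -> uniformly_semiconvex D phi ->
   exists C : R, \forall c \near +oo, forall u : 'rV[R]_n -> R,
     viscosity_solution k A b D phi c u ->
     forall x : 'rV[R]_n, c <= enorm x ->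
       Q A b c x - C * c ^+ (n - 1) * enorm x ^- (n - 2) <= u x <= Q A b c x)
  /\
  (smooth_domain D -> strictly_star_shaped D ->
   strictly_convex_boundary (k - 1) D -> smooth_on_boundary D phi ->
   exists C : R, \forall c \near +oo, forall u : 'rV[R]_n -> R,
     classical_solution k A b D phi c u ->
     forall x : 'rV[R]_n, c <= enorm x ->
       Q A b c x - C * c ^+ (n - 1) * enorm x ^- (n - 2) <= u x <= Q A b c x).
Proof.
case: n hn A b D phi hk hA hD => [|[|[|m]]] // _ A b D phi; case: k => // k hk hA hD.
have [_ _ _ bD] := hD; have [sA _ _] := hA.
have main : {within bdry D, continuous phi} -> exists c0 : R, forall c, c0 < c -> forall u,
    viscosity_solution k.+1 A b D phi c u -> forall x, c <= enorm x ->
    Q A b c x - 4 * c ^+ m.+2 * enorm x ^- m.+1 <= u x <= Q A b c x.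
  move=> cphi; have [M M0 hM] := boundary_bound b sA bD cphi.
  exact: exterior_estimate hA bD M0 hM.
split=> [_ _ cphi _ | _ _ _ sphi].
  have [c0 h] := main cphi; exists 4; exists c0; split; first exact: num_real.
  by move=> c /h hc u /hc.
have [c0 h] := main (smooth_on_boundary_continuous sphi).
exists 4; exists c0; split; first exact: num_real.
by move=> c /h hc u /classical_viscosity_solution /hc.
Qed.
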